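(* The space $\mathsf{cf}(\mathrm{UT}_\bullet)=\bigoplus_{n\ge0}\mathsf{cf}(\mathrm{UT}_n)$ is a graded connected Hopf algebra with product and coproduct $$\mu=\bigoplus_{n\ge i\ge0}\mathrm{Inf}^{\mathrm{UT}_n}_{\mathrm{UL}_{[i]}}\circ\mathrm{st}^{-1}_{([i],[i]^c)},\qquad \Delta=\bigoplus_{n\ge0}\sum_{I\subseteq[n]}\mathrm{st}_{(I,I^c)}\circ\mathrm{Def}^{\mathrm{UP}_I}_{\mathrm{UL}_I}\circ\mathrm{Res}^{\mathrm{UT}_n}_{\mathrm{UP}_I}.$$ Moreover, there is a graded isomorphism of Hopf algebras $\mathsf{cf}(\mathrm{UT}_\bullet)\cong\overline{\mathcal{K}}(\mathbf{cf})$.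
   Context: Fix the finite field $\mathbb{F}_q$; $[n]=\{1,\dots,n\}$. $\mathrm{UT}_n$ is the group of $n\times n$ unipotent upper triangular matrices over $\mathbb{F}_q$; $\mathsf{cf}(G)$ denotes complex class functions on $G$. For $I\subseteq[n]$, $I^c=[n]\setminus I$, define subgroups of $\mathrm{UT}_n$: $\mathrm{UL}_I=\{g:(g-1_n)_{i,j}\neq0\text{ only if }(i,j)\in I\times I\cup I^c\times I^c\}$, $\mathrm{UR}_I=\{g:(g-1_n)_{i,j}\ne0\text{ only if }(i,j)\in I\times I^c\}$, $\mathrm{UP}_I=\{g:(g-1_n)_{i,j}=0\text{ whenever }(i,j)\in I^c\times I\}$. Then $\mathrm{UP}_I=\mathrm{UL}_I\ltimes\mathrm{UR}_I$, and $\mathrm{UP}_{[i]}=\mathrm{UT}_n$. $\mathrm{Inf}^{\mathrm{UT}_n}_{\mathrm{UL}_{[i]}}\psi(lr)=\psi(l)$ ($l\in\mathrm{UL}_{[i]}$, $r\in\mathrm{UR}_{[i]}$), $\mathrm{Res}$ is restriction, and $\mathrm{Def}^{\mathrm{UP}_I}_{\mathrm{UL}_I}\psi(g)=\frac1{|\mathrm{UR}_I|}\sum_{x\in\mathrm{UR}_I}\psi(gx)$. For $I\subseteq[n]$ let $\mathrm{cano}_I:I\to[|I|]$ be the order-preserving bijection; the isomorphism $\mathrm{UT}_{|I|}\times\mathrm{UT}_{|I^c|}\to\mathrm{UL}_I$, $(g_1,g_2)\mapsto$ the matrix with $(\mathrm{cano}_I^{-1}(r),\mathrm{cano}_I^{-1}(s))$-entry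 $(g_1)_{r,s}$, $(\mathrm{cano}_{I^c}^{-1}(r),\mathrm{cano}_{I^c}^{-1}(s))$-entry $(g_2)_{r,s}$, and zeros elsewhere, induces the straightening isomorphism $\mathrm{st}_{(I,I^c)}:\mathsf{cf}(\mathrm{UL}_I)\to\mathsf{cf}(\mathrm{UT}_{|I|})\otimes\mathsf{cf}(\mathrm{UT}_{|I^c|})$. $\mathbf{cf}$ is the connected Hopf monoid (in vector species over $\mathbb{C}$) with $\mathbf{cf}[I]=\bigoplus_{\tau}\mathsf{cf}(\mathrm{UT}(\tau))$ over total orders $\tau$ of the finite set $I$ (where $\mathrm{UT}(\tau)$ is the group of invertible $I\times I$ matrices $X$ with $(X-1)_{i,j}\neq0$ only if $(i,j)\in\tau$), $\mathbf{cf}[\sigma]\psi=\psi\circ\sigma^{-1}$ for bijections $\sigma$ (acting on matrices by relabelling indices), product $\mu_{(S,T)}$ on the summand $(\tau_1,\tau_2)$ given by inflation from $\mathrm{UT}(\tau_1)\oplus\mathrm{UT}(\tau_2)$ to $\mathrm{UT}(\tau_1\sqcup\tau_2\sqcup S\times T)$, and coproduct $\Delta_{(S,T)}$ on the summand $\mathsf{cf}(\mathrm{UT}(\phi))$ given by restriction to the subgroup of $\mathrm{UT}(\phi)$ with no nonzero entries in $T\times S$, followed by deflation to $\mathrm{UT}(\phi|_S)\oplus\mathrm{UT}(\phi|_T)$ (averaging over the normal complement with nonzero off-diagonal entries only in $\phi\cap(S\times T)$). The Fock functor $\overline{\mathcal{K}}$ sends a connected Hopf monoid $\mathbf{h}$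 to $\overline{\mathcal{K}}(\mathbf{h})=\bigoplus_{n\ge0}(\mathbf{h}[n])_{S_n}$ (coinvariants $\mathbf{h}[n]/\langle v-\mathbf{h}[\sigma]v\rangle$), a graded connected Hopf algebra with product $\bigoplus_{n\ge i\ge0}\mu_{([i],[i]^c)}\circ\mathrm{st}^{-1}_{([i],[i]^c)}$ and coproduct $\bigoplus_n\sum_{I\subseteq[n]}\mathrm{st}_{(I,I^c)}\circ\Delta_{(I,I^c)}$, where $\mathrm{st}_{(I,I^c)}=\mathbf{h}[\mathrm{cano}_I]\otimes\mathbf{h}[\mathrm{cano}_{I^c}]$ on coinvariants. *)

(* Defs.v *)
From mathcomp Require Import all_boot all_order all_algebra all_fingroup.
From mathcomp Require Import complex Rstruct.

Set Implicit Arguments.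
Unset Strict Implicit.
Unset Printing Implicit Defensive.

Import GRing.Theory.
Local Open Scope ring_scope.

Definition CC : fieldType := (Rdefinitions.R)[i].

Section UTClassFunctions.
Variable F : finFieldType.

(* ---- index helpers (indices are 0-based: [n] = {0,...,n-1}) ---- *)

Definition ent n (X : 'M[F]_n) (a b : nat) : F :=
  match (insub a : option 'I_n), (insub b : option 'I_n) with
  | Some r, Some s => X r s
  | _, _ => 0
  end.

Definition subm n k (f : nat -> nat) (X : 'M[F]_n) : 'M[F]_k :=
  \matrix_(r < k, s < k) ent X (f r) (f s).

Definition clist n (I : {set 'I_n}) : seq nat := sort leq [seq val x | x <- enum I].
Definition cinv n (I : {set 'I_n}) (k : nat) : nat := nth 0 (clist I) k.
Definition cano n (I : {set 'I_n}) (a : nat) : nat := index a (clist I).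

Definition pv k (s : 'S_k) (a : nat) : nat :=
  match (insub a : option 'I_k) with Some x => val (s x) | None => a end.

Definition isUTr n (r : rel 'I_n) (X : 'M[F]_n) : bool :=
  [forall a, forall b, ~~ r a b ==> (X a b == (a == b)%:R)].

Definition natrel n : rel 'I_n := fun a b => (a < b)%N.
(* the total order on [n] encoded by a rank permutation s: a <_s b iff s a < s b *)
Definition ordrel n (s : 'S_n) : rel 'I_n := fun a b => (s a < s b)%N.

Definition isUT n (X : 'M[F]_n) := isUTr (@natrel n) X.

(* class functions on UT(r), viewed as functions on matrices vanishing off UT(r) *)
Definition is_cfr n (r : rel 'I_n) (f : 'M[F]_n -> CC) : Prop :=
  (forall X, ~~ isUTr r X -> f X = 0) /\
  (forall g h, isUTr r g -> isUTr r h -> f (h *m g *m invmx h) = f g).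

Definition is_cf n (f : 'M[F]_n -> CC) := is_cfr (@natrel n) f.

(* cf(UT_i) (x) cf(UT_j), as functions of two matrices *)
Definition is_cf2 i j (G : 'M[F]_i -> 'M[F]_j -> CC) :=
  (forall Y2, is_cf (G^~ Y2)) /\ (forall Y1, is_cf (G Y1)).

Definition is_cf3 i j k (G : 'M[F]_i -> 'M[F]_j -> 'M[F]_k -> CC) :=
  (forall Y2 Y3, is_cf (fun Y1 => G Y1 Y2 Y3)) /\
  (forall Y1 Y3, is_cf (fun Y2 => G Y1 Y2 Y3)) /\
  (forall Y1 Y2, is_cf (G Y1 Y2)).

(* ---- the product  mu = Inf^{UT_n}_{UL_[i]} o st^{-1}_{([i],[i]^c)}  (n = i + j) ---- *)
Definition mu n i j (G : 'M[F]_i -> 'M[F]_j -> CC) : 'M[F]_n -> CC :=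
  fun X => if isUT X then G (subm i id X) (subm j (addn i) X) else 0.

(* st^{-1}_{(I,I^c)}: the element of UL_I built from (Y1, Y2) *)
Definition embed n i j (I : {set 'I_n}) (Y1 : 'M[F]_i) (Y2 : 'M[F]_j) : 'M[F]_n :=
  \matrix_(a < n, b < n)
    if (a \in I) && (b \in I) then ent Y1 (cano I a) (cano I b)
    else if (a \notin I) && (b \notin I) then ent Y2 (cano (~: I) a) (cano (~: I) b)
    else 0.

Definition isUR n (I : {set 'I_n}) (x : 'M[F]_n) : bool :=
  isUTr (fun a b => [&& (a < b)%N, a \in I & b \notin I]) x.

(* st_{(I,I^c)} o Def^{UP_I}_{UL_I} o Res^{UT_n}_{UP_I} *)
Definition stDefRes n i j (I : {set 'I_n}) (f : 'M[F]_n -> CC)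
    (Y1 : 'M[F]_i) (Y2 : 'M[F]_j) : CC :=
  if isUT Y1 && isUT Y2 then
    (#|[pred x | isUR I x]|%:R)^-1 *
      \sum_(x : 'M[F]_n | isUR I x) f (embed I Y1 Y2 *m x)
  else 0.

(* component of Delta in cf(UT_i) (x) cf(UT_j), n = i + j *)
Definition Delta n i j (f : 'M[F]_n -> CC) : 'M[F]_i -> 'M[F]_j -> CC :=
  fun Y1 Y2 => \sum_(I : {set 'I_n} | #|I| == i) stDefRes I f Y1 Y2.

(* An element of cf[[n]] = (+)_{tau} cf(UT(tau)) is a function Phi of
   (s, X), s : 'S_n the rank permutation of the total order tau, X a matrix;
   Phi(s, -) is a class function on UT(tau). *)
Definition Krep n (Phi : 'S_n * 'M[F]_n -> CC) :=
  forall s, is_cfr (ordrel s) (fun X => Phi (s, X)).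

Definition Krep2 i j (Psi : 'S_i * 'M[F]_i -> 'S_j * 'M[F]_j -> CC) :=
  (forall p2, Krep (Psi^~ p2)) /\ (forall p1, Krep (Psi p1)).

Definition relabel n (p : 'S_n) (Y : 'M[F]_n) : 'M[F]_n :=
  \matrix_(a, b) Y (p a) (p b).

(* the S_n action  cf[p] psi = psi o p^{-1} *)
Definition Kact n (p : 'S_n) (Phi : 'S_n * 'M[F]_n -> CC) : 'S_n * 'M[F]_n -> CC :=
  fun q => Phi ((p * q.1)%g, relabel p q.2).

(* the order on [n] obtained by putting the order s1 on [i] below the
   order s2 on [i]^c = {i,...,n-1} (transported by cano) *)
Definition isconcat n i j (s : 'S_n) (s1 : 'S_i) (s2 : 'S_j) : bool :=
  [forall a : 'I_n, val (s a) == if (a < i)%N then pv s1 a else i + pv s2 (a - i)].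

(* product of K(cf): mu_{([i],[i]^c)} o st^{-1}, on representatives *)
Definition Kmu n i j (Psi : 'S_i * 'M[F]_i -> 'S_j * 'M[F]_j -> CC)
    : 'S_n * 'M[F]_n -> CC :=
  fun q => \sum_(s1 : 'S_i) \sum_(s2 : 'S_j)
     if isconcat q.1 s1 s2 && isUTr (ordrel q.1) q.2
     then Psi (s1, subm i id q.2) (s2, subm j (addn i) q.2) else 0.

(* s1 is (the rank permutation of) cano_I(s|_I) *)
Definition isrestr n k (I : {set 'I_n}) (s : 'S_n) (s1 : 'S_k) : bool :=
  [forall a : 'I_k, forall b : 'I_k,
     (s1 a < s1 b)%N == (pv s (cinv I a) < pv s (cinv I b))%N].

Definition isRs n (I : {set 'I_n}) (s : 'S_n) (x : 'M[F]_n) : bool :=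
  isUTr (fun a b => [&& (s a < s b)%N, a \in I & b \notin I]) x.

(* coproduct of K(cf): sum_I st_{(I,I^c)} o Delta_{(I,I^c)}, component in
   degree (i, j), on representatives *)
Definition KDelta n i j (Phi : 'S_n * 'M[F]_n -> CC)
    : 'S_i * 'M[F]_i -> 'S_j * 'M[F]_j -> CC :=
  fun p1 p2 =>
   \sum_(I : {set 'I_n} | #|I| == i) \sum_(s : 'S_n | isrestr I s p1.1 && isrestr (~: I) s p2.1)
     if isUTr (ordrel p1.1) p1.2 && isUTr (ordrel p2.1) p2.2 then
       (#|[pred x | isRs I s x]|%:R)^-1 *
         \sum_(x : 'M[F]_n | isRs I s x) Phi (s, embed I p1.2 p2.2 *m x)
     else 0.

End UTClassFunctions.

Definition islinmap (T U : Type) (phi : (T -> CC) -> (U -> CC)) : Prop :=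
  forall (a : CC) (f g : T -> CC),
    phi (fun x => a * f x + g x) = (fun y => a * phi f y + phi g y).

Definition tens (T1 T2 U1 U2 : Type) (phi1 : (T1 -> CC) -> (U1 -> CC))
    (phi2 : (T2 -> CC) -> (U2 -> CC)) (G : T1 -> T2 -> CC) : U1 -> U2 -> CC :=
  fun y1 y2 => phi1 (fun x1 => phi2 (G x1) y2) y1.

Arguments mu {F} n i j G _.
Arguments Delta {F n} i j f _ _.
Arguments Kmu {F} n i j Psi _.
Arguments KDelta {F n} i j Phi _ _.

(* Main.v *)
Require Import Defs.
From mathcomp Require Import all_boot all_order all_algebra all_fingroup.
From mathcomp Require Import complex Rstruct.
From mathcomp Require Import zify.
From Stdlib Require Import FunctionalExtensionality.

(** Left translation turns the deflation into a fibre sum: the (i, j)-component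
    of the coproduct is
      Delta f (Y1, Y2) = sum over I, |I| = i, of q^(-inv I) times the sum of
      f M over the M in UT_n with diagonal blocks M_(I,I) = Y1, M_(I^c,I^c) = Y2
      and M_(I^c,I) = 0,
    where inv I counts the pairs a < b with a in I and b outside I.  In this form
    both iterated coproducts are the sum over chains A c I of the fibres over
    three diagonal blocks, the intermediate matrix being a diagonal block of M.  For
    multiplicativity, I splits as J1 + J2 along [a] + [a]^c, and of the upper
    right block of M only the rows J1 and columns J2^c are free, which matches
    inv I = inv J1 + inv J2 + |J1||J2^c|.  The antipode is Takeuchi's alternating
    sum of convolution powers.  The isomorphism with the Fock space sends a family
    of class functions indexed by total orders to the sum of its components, each
    transported to the standard order. *)

Set Implicit Arguments.
Unset Strict Implicit.
Unset Printing Implicit Defensive.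
Import GRing.Theory.
Local Open Scope ring_scope.

(** Class functions are functions on all matrices that vanish off the group, and elements of tensor
    products are functions of several matrices, so every identity to be proved is one between finite
    sums of values. An operator acts on one tensor factor by being applied in one variable while the
    other variables are parameters; the interchange laws of tensor products then reduce to the fact
    that a linear map commutes with finite sums. The degree [n] stays a parameter of [mu] and
    [Delta], tied to [i + j] only by a hypothesis, so that both bracketings of an iterated product
    or coproduct have the same type and no casts occur. Fibres are described by conditions on
    entries rather than as cosets: [lz I] is block triangularity, under which taking diagonal blocks
    is multiplicative, and [agree I] is equality off the single free block I x I^c. *)

(** * Increasing enumeration of a set of indices *)

Section Enumeration.
Variable n : nat.
Implicit Types (I : {set 'I_n}) (x : 'I_n).

Lemma size_clist I : size (clist I) = #|I|.
Proof. by rewrite size_sort size_map -cardE. Qed.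

Lemma mem_clist I x : (val x \in clist I) = (x \in I).
Proof. by rewrite mem_sort (mem_map val_inj) mem_enum. Qed.

Lemma clistP I k : reflect (exists2 x, x \in I & val x = k) (k \in clist I).
Proof.
rewrite mem_sort; apply: (iffP mapP) => [[x xI ->]|[x xI <-]].
  by exists x => //; rewrite -mem_enum.
by exists x; rewrite ?mem_enum.
Qed.

Lemma clist_uniq I : uniq (clist I).
Proof. by rewrite sort_uniq (map_inj_uniq val_inj) enum_uniq. Qed.

Lemma clist_sorted I : sorted ltn (clist I).
Proof.
by rewrite ltn_sorted_uniq_leq clist_uniq; apply: sort_sorted; apply: leq_total.
Qed.

(** A strictly increasing list is determined by its members. Each explicit computation of a [clist]
    below is reduced to this. *)
Lemma clist_unique I s : sorted ltn s ->
  (forall k, (k \in s) = (k \in clist I)) -> clist I = s.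
Proof.
move=> ss eqs; apply: (irr_sorted_eq ltn_trans ltnn (clist_sorted I) ss) => k.
by rewrite eqs.
Qed.

Lemma cinv_lt I k : (k < #|I|)%N -> (cinv I k < n)%N.
Proof.
rewrite -size_clist => /(mem_nth 0%N)/clistP[x _ e].
by rewrite /cinv -e; apply: ltn_ord.
Qed.

Lemma cinv_mem I x k : (k < #|I|)%N -> val x = cinv I k -> x \in I.
Proof. by rewrite -mem_clist => kI ->; rewrite mem_nth ?size_clist. Qed.

Lemma cinv_mono I k l : (k < #|I|)%N -> (l < #|I|)%N ->
  (cinv I k < cinv I l)%N = (k < l)%N.
Proof.
rewrite -size_clist => kI lI.
have H := sorted_ltn_nth ltn_trans 0%N (clist_sorted I).
case: (ltngtP k l) => [kl|lk|->]; last by rewrite ltnn.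
  exact: H.
by apply/negbTE; rewrite -leqNgt ltnW //; apply: H.
Qed.

Lemma cano_lt I x : x \in I -> (cano I x < #|I|)%N.
Proof. by rewrite -mem_clist -index_mem size_clist. Qed.

Lemma cinvK I k : (k < #|I|)%N -> cano I (cinv I k) = k.
Proof. by move=> kI; rewrite /cano /cinv index_uniq ?size_clist ?clist_uniq. Qed.

Lemma canoK I x : x \in I -> cinv I (cano I x) = x.
Proof. by rewrite -mem_clist => xI; rewrite /cinv nth_index. Qed.

(** This is [cinv] with ordinal values, along which sums and sets can be transported. The size [k]
    is tied to [#|I|] by a proof, since the two are rarely convertible. *)
Definition emb k I (h : #|I| = k) (r : 'I_k) : 'I_n :=
  Ordinal (@cinv_lt I r (eq_ind_r (fun m => (r < m)%N) (ltn_ord r) h)).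

Lemma val_emb k I (h : #|I| = k) r : val (emb h r) = cinv I r.
Proof. by []. Qed.

Lemma emb_mem k I (h : #|I| = k) r : emb h r \in I.
Proof. by apply: (@cinv_mem I _ r); rewrite ?h. Qed.

Lemma emb_inj k I (h : #|I| = k) : injective (emb h).
Proof.
move=> r s /(congr1 val) /= e; apply: val_inj.
by rewrite /= -(@cinvK I r) ?h // e cinvK ?h.
Qed.

Lemma emb_mono k I (h : #|I| = k) r s : (emb h r < emb h s)%N = (r < s)%N.
Proof. by rewrite cinv_mono ?h. Qed.

Lemma embP k I (h : #|I| = k) x : x \in I -> exists r, emb h r = x.
Proof.
move=> xI; have xk : (cano I x < k)%N by rewrite -h cano_lt.
by exists (Ordinal xk); apply: val_inj; rewrite /= canoK.
Qed.

Lemma imset_emb k I (h : #|I| = k) : [set emb h r | r : 'I_k] = I.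
Proof.
apply/setP=> x; apply/imsetP/idP => [[r _ ->]|/(embP h)[r <-]].
  exact: emb_mem.
by exists r.
Qed.

Lemma big_emb (R : Type) (idx : R) (op : Monoid.com_law idx) k I
    (h : #|I| = k) (g : 'I_n -> R) :
  \big[op/idx]_(r < k) g (emb h r) = \big[op/idx]_(x in I) g x.
Proof.
rewrite -{2}(imset_emb h) big_imset //= => r s _ _.
exact: emb_inj.
Qed.

End Enumeration.

(** The composite of two increasing enumerations is increasing, hence enumerates its image. Thus two
    successive straightenings amount to one. *)
Lemma cinv_imset n k (I : {set 'I_n}) (h : #|I| = k) (J : {set 'I_k}) r :
  (r < #|J|)%N -> cinv (emb h @: J) r = cinv I (cinv J r).
Proof.
move=> rJ; rewrite /cinv; have -> : clist (emb h @: J) = map (nth 0%N (clist I)) (clist J).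
  apply: clist_unique => [|m].
    apply: (@homo_sorted_in _ _ [pred x | (x < k)%N] (nth 0%N (clist I)) ltn).
    - by move=> a b /= ak bk; rewrite (@cinv_mono _ I) ?h.
    - by apply/allP=> a /clistP[x _ <-] /=.
    exact: clist_sorted.
  apply/mapP/clistP=> [[a /clistP[x xJ <-] ->]|[x /imsetP[y yJ ->] <-]].
    by exists (emb h x) => //; apply: imset_f.
  by exists (val y); rewrite ?mem_clist.
by rewrite (nth_map 0%N) ?size_clist.
Qed.

Lemma cinv_setT n k : (k < n)%N -> cinv [set: 'I_n] k = k.
Proof.
move=> kn; rewrite /cinv; have -> : clist [set: 'I_n] = iota 0 n.
  apply: clist_unique => [|m]; first exact: iota_ltn_sorted.
  rewrite mem_iota /= add0n; apply/idP/clistP => [mn|[x _ <-]]; last exact: ltn_ord.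
  by exists (Ordinal mn); rewrite ?inE.
by rewrite nth_iota.
Qed.

(** * Submatrices, unitriangular and block triangular matrices, fibres over diagonal blocks *)

Section Matrices.
Variable F : finFieldType.

Lemma entE n (X : 'M[F]_n) (a b : 'I_n) : ent X a b = X a b.
Proof. by rewrite /ent !valK. Qed.

Lemma ent_eq n (X : 'M[F]_n) (x y : 'I_n) a b :
  val x = a -> val y = b -> ent X a b = X x y.
Proof. by move=> <- <-; rewrite entE. Qed.

Lemma submE n k (f : nat -> nat) (X : 'M[F]_n) (r s : 'I_k) (x y : 'I_n) :
  val x = f r -> val y = f s -> subm k f X r s = X x y.
Proof. by move=> xr ys; rewrite mxE (ent_eq _ xr ys). Qed.

Lemma subm_emb n k (I : {set 'I_n}) (h : #|I| = k) (X : 'M[F]_n) r s :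
  subm k (cinv I) X r s = X (emb h r) (emb h s).
Proof. exact: submE. Qed.

Lemma eq_subm n k f g (X : 'M[F]_n) :
  (forall r, (r < k)%N -> f r = g r) -> subm k f X = subm k g X.
Proof. by move=> fg; apply/matrixP=> r s; rewrite !mxE !fg. Qed.

Lemma subm_subm n m k f g (X : 'M[F]_n) :
  (forall r, (r < k)%N -> (f r < m)%N) ->
  subm k f (subm m g X) = subm k (g \o f) X.
Proof.
move=> fk; apply/matrixP=> r s; rewrite [RHS]mxE /=.
by rewrite (@submE _ _ _ _ _ _ (Ordinal (fk r (ltn_ord r))) (Ordinal (fk s (ltn_ord s)))) // mxE.
Qed.

Lemma subm_id n (X : 'M[F]_n) : subm n id X = X.
Proof. by apply/matrixP=> r s; apply: submE. Qed.

Lemma isUTrP n (r : rel 'I_n) (X : 'M[F]_n) :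
  reflect (forall a b, ~~ r a b -> X a b = (a == b)%:R) (isUTr r X).
Proof.
apply: (iffP 'forall_forallP) => H a b; first by move: (H a b) => /implyP h /h/eqP.
by apply/implyP=> /H ->.
Qed.

Lemma isUTP n (X : 'M[F]_n) :
  reflect (forall a b : 'I_n, (b <= a)%N -> X a b = (a == b)%:R) (isUT X).
Proof.
apply: (iffP (isUTrP _ _)) => H a b; first by rewrite leqNgt => /H.
by rewrite /natrel -leqNgt => /H.
Qed.

Lemma isUT_subm n k f (X : 'M[F]_n) :
  (forall r, (r < k)%N -> (f r < n)%N) ->
  (forall r s, (r < s < k)%N -> (f r < f s)%N) -> isUT X -> isUT (subm k f X).
Proof.
move=> fn fm /isUTP UX; apply/isUTP => r s sr.
rewrite (@submE _ _ _ _ _ _ (Ordinal (fn r (ltn_ord r))) (Ordinal (fn s (ltn_ord s)))) //.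
have [e|ne] := eqVneq r s; first by rewrite e UX // eqxx.
have lt : (f s < f r)%N.
  by apply: fm; rewrite ltn_ord ltn_neqAle sr andbT eq_sym val_eqE ne.
rewrite UX /=; last exact: ltnW.
by rewrite -val_eqE /= gtn_eqF.
Qed.

Lemma isUT_subm_cinv n k (I : {set 'I_n}) (X : 'M[F]_n) :
  #|I| = k -> isUT X -> isUT (subm k (cinv I) X).
Proof.
move=> h; apply: isUT_subm => [r rk|r s /andP[rs sk]]; first by rewrite cinv_lt ?h.
by rewrite cinv_mono ?h // (ltn_trans rs).
Qed.

Lemma isUT1 n : isUT (1%:M : 'M[F]_n).
Proof. by apply/isUTP=> a b _; rewrite mxE. Qed.

Lemma isUTM n (X Y : 'M[F]_n) : isUT X -> isUT Y -> isUT (X *m Y).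
Proof.
move=> /isUTP UX /isUTP UY; apply/isUTP=> a b ba; rewrite mxE (bigD1 a) //=.
rewrite (UX a a) // eqxx mul1r (UY a b) // big1 ?addr0 // => c ca.
have [lt|le] := ltnP c a; first by rewrite UX ?(ltnW lt) // eq_sym (negbTE ca) mul0r.
rewrite UY ?(leq_trans ba) //; have [e|] := eqVneq c b; last by rewrite mulr0.
by case/eqP: ca; apply: val_inj; apply/eqP; rewrite eqn_leq le e ba.
Qed.

Lemma isUT_unit n (X : 'M[F]_n) : isUT X -> X \in unitmx.
Proof.
move=> /isUTP UX; rewrite unitmxE -det_tr det_trig.
  by rewrite big1 ?unitr1 // => i _; rewrite mxE UX ?eqxx.
apply/is_trig_mxP => i j ij; rewrite mxE UX ?(ltnW ij) //.
by rewrite -val_eqE /= gtn_eqF.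
Qed.

(** Left multiplication by [h] is an injective self-map of the finite set of matrices satisfying
    [P], hence surjective, so it attains 1. No formula for the inverse is required. *)
Lemma mx_closed_inv n (P : pred 'M[F]_n) (h : 'M[F]_n) :
  h \in unitmx -> P 1%:M -> P h -> (forall X Y, P X -> P Y -> P (X *m Y)) ->
  P (invmx h).
Proof.
move=> uh P1 Ph PM; have inj : injective (@mulmx F n n n h).
  by move=> X Y /(congr1 (mulmx (invmx h))); rewrite !mulKmx.
have sub : @mulmx F n n n h @: [set X | P X] \subset [set X | P X].
  by apply/subsetP=> _ /imsetP[X PX ->]; move: PX; rewrite !inE; apply: PM.
have : 1%:M \in @mulmx F n n n h @: [set X | P X].
  by rewrite (subset_cardP (card_imset _ inj) sub) inE.
case/imsetP=> X; rewrite inE => PX e.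
suff -> : invmx h = X by [].
by rewrite -[X](mulKmx uh) -e mulmx1.
Qed.

Lemma isUT_inv n (X : 'M[F]_n) : isUT X -> isUT (invmx X).
Proof.
move=> UX; apply: mx_closed_inv => //; [exact: isUT_unit|exact: isUT1|].
by move=> ? ?; apply: isUTM.
Qed.

Lemma isUT_conj n (h X : 'M[F]_n) : isUT h -> isUT (h *m X *m invmx h) = isUT X.
Proof.
move=> Uh; apply/idP/idP => U; last by rewrite isUTM ?isUT_inv ?isUTM.
have -> : X = invmx h *m (h *m X *m invmx h) *m h.
  by rewrite -mulmxA mulmxKV ?isUT_unit // mulKmx ?isUT_unit.
by apply: isUTM => //; apply: isUTM => //; apply: isUT_inv.
Qed.

(** Vanishing of the lower left block I^c x I, the condition that cuts UP_I out of UT_n. *)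
Definition lz n (I : {set 'I_n}) (X : 'M[F]_n) : bool :=
  [forall a, forall b, (a \notin I) && (b \in I) ==> (X a b == 0)].

Lemma lzP n (I : {set 'I_n}) (X : 'M[F]_n) :
  reflect (forall a b, a \notin I -> b \in I -> X a b = 0) (lz I X).
Proof.
apply: (iffP 'forall_forallP) => H a b.
  by move=> aI bI; move: (H a b); rewrite aI bI => /eqP.
by apply/implyP=> /andP[aI bI]; rewrite H.
Qed.

Lemma lz1 n (I : {set 'I_n}) : lz I 1%:M.
Proof. by apply/lzP=> a b aI bI; rewrite mxE; case: eqP aI bI => [->/negbTE->|]. Qed.

Lemma lzM n (I : {set 'I_n}) (X Y : 'M[F]_n) : lz I X -> lz I Y -> lz I (X *m Y).
Proof.
move=> /lzP LX /lzP LY; apply/lzP=> a b aI bI; rewrite mxE big1 // => c _.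
by have [cI|cI] := boolP (c \in I); [rewrite LX ?mul0r | rewrite LY ?mulr0].
Qed.

Lemma lz_inv n (I : {set 'I_n}) (X : 'M[F]_n) :
  X \in unitmx -> lz I X -> lz I (invmx X).
Proof.
move=> uX LX; apply: mx_closed_inv => //; first exact: lz1.
by move=> ? ?; apply: lzM.
Qed.

(** In an entry of the product indexed by I x I, the intermediate indices outside I meet the zero
    block of the right factor. For I^c x I^c it is the left factor that must have the zero block. *)
Lemma subm_mul n k (I : {set 'I_n}) (X Y : 'M[F]_n) : #|I| = k ->
  lz I Y -> subm k (cinv I) (X *m Y) = subm k (cinv I) X *m subm k (cinv I) Y.
Proof.
move=> h /lzP LY; apply/matrixP=> r s; rewrite (subm_emb h) !mxE.
rewrite (bigID (mem I)) /= [X in _ + X]big1 ?addr0; last first.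
  by move=> c cI; rewrite LY ?emb_mem ?mulr0.
by rewrite -(big_emb _ h); apply: eq_bigr => c _; rewrite !(subm_emb h).
Qed.

Lemma subm_mulC n k (I : {set 'I_n}) (X Y : 'M[F]_n) : #|~: I| = k -> lz I X ->
  subm k (cinv (~: I)) (X *m Y) = subm k (cinv (~: I)) X *m subm k (cinv (~: I)) Y.
Proof.
move=> h /lzP LX; apply/matrixP=> r s; rewrite (subm_emb h) !mxE.
rewrite (bigID (mem I)) /= big1 ?add0r; last first.
  by move=> c cI; rewrite LX ?mul0r // -in_setC emb_mem.
rewrite (eq_bigl (mem (~: I))) => [|c]; last by rewrite !inE.
by rewrite -(big_emb _ h); apply: eq_bigr => c _; rewrite !(subm_emb h).
Qed.

Lemma subm1 n k (I : {set 'I_n}) : #|I| = k ->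
  subm k (cinv I) (1%:M : 'M[F]_n) = 1%:M.
Proof.
move=> h; apply/matrixP=> r s; rewrite (subm_emb h) !mxE.
by rewrite (inj_eq (@emb_inj _ _ _ h)).
Qed.

Lemma card_setC n i j (I : {set 'I_n}) : (i + j = n)%N -> #|I| = i -> #|~: I| = j.
Proof. by move=> ij iI; have := cardsC I; rewrite card_ord iI; lia. Qed.

Lemma embed_in n i j (I : {set 'I_n}) (Y1 : 'M[F]_i) (Y2 : 'M[F]_j)
    (h : #|I| = i) r s : embed I Y1 Y2 (emb h r) (emb h s) = Y1 r s.
Proof. by rewrite mxE !emb_mem /= !cinvK ?h ?entE. Qed.

Lemma embed_out n i j (I : {set 'I_n}) (Y1 : 'M[F]_i) (Y2 : 'M[F]_j)
    (h : #|~: I| = j) r s : embed I Y1 Y2 (emb h r) (emb h s) = Y2 r s.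
Proof.
have := emb_mem h r; have := emb_mem h s; rewrite !inE => sI rI.
by rewrite mxE (negbTE sI) (negbTE rI) /= !cinvK ?h ?entE.
Qed.

Lemma embed_off n i j (I : {set 'I_n}) (Y1 : 'M[F]_i) (Y2 : 'M[F]_j) a b :
  (a \in I) != (b \in I) -> embed I Y1 Y2 a b = 0.
Proof. by rewrite mxE; case: (a \in I); case: (b \in I). Qed.

Lemma embed_lz n i j (I : {set 'I_n}) (Y1 : 'M[F]_i) (Y2 : 'M[F]_j) :
  lz I (embed I Y1 Y2).
Proof. by apply/lzP=> a b /negbTE aI bI; rewrite embed_off // aI bI. Qed.

Lemma subm_embed n i j (I : {set 'I_n}) (Y1 : 'M[F]_i) (Y2 : 'M[F]_j) :
  #|I| = i -> subm i (cinv I) (embed I Y1 Y2) = Y1.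
Proof. by move=> h; apply/matrixP=> r s; rewrite (subm_emb h) embed_in. Qed.

Lemma subm_embedC n i j (I : {set 'I_n}) (Y1 : 'M[F]_i) (Y2 : 'M[F]_j) :
  #|~: I| = j -> subm j (cinv (~: I)) (embed I Y1 Y2) = Y2.
Proof. by move=> h; apply/matrixP=> r s; rewrite (subm_emb h) embed_out. Qed.

Lemma isUT_embed n i j (I : {set 'I_n}) (Y1 : 'M[F]_i) (Y2 : 'M[F]_j) :
  #|I| = i -> #|~: I| = j -> isUT Y1 -> isUT Y2 -> isUT (embed I Y1 Y2).
Proof.
move=> h h' /isUTP U1 /isUTP U2; apply/isUTP => a b ba.
have [aI|aI] := boolP (a \in I); have [bI|bI] := boolP (b \in I).
- move: ba; have [r <-] := embP h aI; have [s <-] := embP h bI.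
  by rewrite leqNgt emb_mono -leqNgt embed_in (inj_eq (@emb_inj _ _ _ h)); apply: U1.
- by rewrite embed_off ?aI ?(negbTE bI) //; case: eqP aI bI => [->->|].
- by rewrite embed_off ?bI ?(negbTE aI) //; case: eqP aI bI => [->/negbTE->|].
move: aI bI ba; rewrite -!in_setC => aI bI; have [r <-] := embP h' aI; have [s <-] := embP h' bI.
by rewrite leqNgt emb_mono -leqNgt embed_out (inj_eq (@emb_inj _ _ _ h')); apply: U2.
Qed.

(** The condition on [(a, b)] is the complement of I x I^c. For unitriangular M, agreement with
    [embed I Y1 Y2] expresses membership in the coset of UR_I through that element. *)
Definition agree n (I : {set 'I_n}) (X Y : 'M[F]_n) : bool :=
  [forall a, forall b, (a \notin I) || (b \in I) ==> (X a b == Y a b)].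

Lemma agreeP n (I : {set 'I_n}) (X Y : 'M[F]_n) :
  reflect (forall a b, (a \notin I) || (b \in I) -> X a b = Y a b) (agree I X Y).
Proof.
apply: (iffP 'forall_forallP) => H a b; first by move=> ab; move: (H a b); rewrite ab => /eqP.
by apply/implyP=> /H ->.
Qed.

(** An entry of L X outside I x I^c only involves entries of X outside that block: a column in I
    avoids it altogether, and a row outside I of L is zero on the indices in I. *)
Lemma agree_mul n (I : {set 'I_n}) (L X Y : 'M[F]_n) :
  lz I L -> agree I X Y -> agree I (L *m X) (L *m Y).
Proof.
move=> /lzP LL /agreeP XY; apply/agreeP=> a b ab; rewrite !mxE.
apply: eq_bigr => c _.
have [cI|cI] := boolP (c \in I); last by rewrite XY ?cI.
have [bI|bI] := boolP (b \in I); first by rewrite XY ?bI ?orbT.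
by move: ab; rewrite (negbTE bI) orbF => aI; rewrite LL ?mul0r.
Qed.

Lemma agree_embed n i j (I : {set 'I_n}) (Y1 : 'M[F]_i) (Y2 : 'M[F]_j) M :
  #|I| = i -> #|~: I| = j ->
  agree I M (embed I Y1 Y2) =
  [&& subm i (cinv I) M == Y1, subm j (cinv (~: I)) M == Y2 & lz I M].
Proof.
move=> h h'; apply/agreeP/and3P => [H|[/eqP e1 /eqP e2 /lzP H] a b].
  split.
  - by apply/eqP/matrixP=> r s; rewrite (subm_emb h) H ?emb_mem ?orbT // embed_in.
  - by apply/eqP/matrixP=> r s; rewrite (subm_emb h') H -?in_setC ?emb_mem // embed_out.
  by apply/lzP=> a b aI bI; rewrite H ?aI // (lzP _ _ (embed_lz I Y1 Y2)).
have [aI|aI] /= := boolP (a \in I).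
  move=> bI; have [r <-] := embP h aI; have [s <-] := embP h bI.
  by rewrite embed_in -e1 (subm_emb h).
move=> _; have [bI|bI] := boolP (b \in I).
  by rewrite H // (lzP _ _ (embed_lz I Y1 Y2)).
move: aI bI; rewrite -!in_setC => aI bI; have [r <-] := embP h' aI; have [s <-] := embP h' bI.
by rewrite embed_out -e2 (subm_emb h').
Qed.

(** Subtracting [X0] identifies these matrices with the functions supported on the positions allowed
    by [r]. *)
Lemma card_mx_free m n (r : 'I_m -> 'I_n -> bool) (X0 : 'M[F]_(m, n)) :
  #|[pred X : 'M[F]_(m, n) | [forall a, forall b, ~~ r a b ==> (X a b == X0 a b)]]|
  = (#|F| ^ \sum_a \sum_b r a b)%N.
Proof.
pose t (X : 'M[F]_(m, n)) : {ffun 'I_m * 'I_n -> F} := [ffun p => X p.1 p.2 - X0 p.1 p.2].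
have inj : injective t.
  move=> X Y /ffunP e; apply/matrixP=> a b; have := e (a, b); rewrite !ffunE /=.
  by move/addIr.
rewrite -(card_imset _ inj) pair_big /=.
have -> : (\sum_p r p.1 p.2 = #|[pred p | r p.1 p.2]|)%N.
  by rewrite -sum1_card [RHS]big_mkcond; apply: eq_bigr => p _; rewrite inE; case: (r _ _).
rewrite -(card_pffun_on (0 : F) [pred p | r p.1 p.2] predT).
apply: eq_card => f; apply/imsetP/pffun_onP => [[X HX ->]|[/supportP fs _]].
  split=> //; apply/supportP => -[a b]; rewrite !inE /= => nr.
  by move: HX; rewrite inE => /'forall_forallP/(_ a b); rewrite ffunE nr => /eqP->; rewrite subrr.
exists (\matrix_(a, b) (f (a, b) + X0 a b)).
  rewrite inE; apply/'forall_forallP=> a b; apply/implyP=> nr.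
  by rewrite mxE fs ?add0r // !inE.
by apply/ffunP=> -[a b]; rewrite ffunE mxE addrK.
Qed.

End Matrices.

(** [CC] is declared only as a field, so characteristic zero is read off from the numeric structure
    of the complex numbers behind it. *)
Lemma natCC_neq0 n : (0 < n)%N -> (n%:R : CC) != 0.
Proof.
move=> n0; have : (n%:R : (Rdefinitions.R)[i]) != 0 by rewrite Num.Theory.pnatr_eq0 -lt0n.
by [].
Qed.

(** Each M lies over exactly one W. This removes the intermediate matrix from an iterated
    coproduct. *)
Lemma sum_fiber (T U : finType) (V : zmodType) (P : pred U) (Q : pred T)
    (g : T -> U) (f : T -> V) :
  \sum_(W | P W) \sum_(M | Q M && (g M == W)) f M = \sum_(M | Q M && P (g M)) f M.
Proof.
rewrite (exchange_big_dep Q) /= => [|W M _ /andP[]//].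
rewrite [RHS]big_mkcondr; apply: eq_bigr => M QM.
rewrite QM /=; case: ifP => PM.
  by rewrite (big_pred1 (g M)) // => W; rewrite /= eq_sym; case: eqP => [->|]; rewrite ?PM ?andbF.
by rewrite big_pred0 // => W; case: eqP => [<-|]; rewrite ?PM ?andbF.
Qed.

(** * The coproduct as a fibre sum, and its invariance under conjugation *)

Section Coproduct.
Variable F : finFieldType.

Definition ninv n (I : {set 'I_n}) : nat :=
  (\sum_(a : 'I_n) \sum_(b : 'I_n) [&& (a < b)%N, a \in I & b \notin I])%N.

Definition qpow (m : nat) : CC := (#|F| ^ m)%:R.

Lemma qpow_neq0 m : qpow m != 0.
Proof. by apply: natCC_neq0; rewrite expn_gt0 (cardD1 0) inE. Qed.

Lemma qpowD m k : qpow (m + k) = qpow m * qpow k.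
Proof. by rewrite /qpow expnD natrM. Qed.

Lemma card_isUR n (I : {set 'I_n}) :
  #|[pred x : 'M[F]_n | isUR I x]| = (#|F| ^ ninv I)%N.
Proof.
rewrite -(card_mx_free (fun a b => [&& (a < b)%N, a \in I & b \notin I]) 1%:M).
apply: eq_card => x; rewrite !inE; apply: eq_forallb => a; apply: eq_forallb => b.
by rewrite mxE.
Qed.

Lemma isUR_agree n (I : {set 'I_n}) (x : 'M[F]_n) :
  isUR I x = isUT x && agree I x 1%:M.
Proof.
apply/isUTrP/andP => [H|[/isUTP H /agreeP H'] a b].
  split; last by apply/agreeP=> a b ab; rewrite H ?mxE // !negb_and negbK ab orbT.
  by apply/isUTP=> a b ba; rewrite H // ltnNge ba.
rewrite !negb_and -leqNgt => /orP[/H //|]; rewrite negbK => /H' ->.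
by rewrite mxE.
Qed.

Lemma isUT_agree n i j (I : {set 'I_n}) (Y1 : 'M[F]_i) (Y2 : 'M[F]_j) M :
  #|I| = i -> #|~: I| = j -> isUT M -> agree I M (embed I Y1 Y2) ->
  isUT Y1 && isUT Y2.
Proof.
move=> h h' UM; rewrite agree_embed // => /and3P[/eqP <- /eqP <- _].
by rewrite !isUT_subm_cinv.
Qed.

(* Left translation by the element of UL_I identifies UR_I with the matrices
   agreeing with that element outside I x I^c. *)
Lemma Delta_kernel n i j (f : 'M[F]_n -> CC) Y1 Y2 : (i + j = n)%N ->
  Delta i j f Y1 Y2 =
  \sum_(I : {set 'I_n} | #|I| == i)
    (qpow (ninv I))^-1 * \sum_(M | isUT M && agree I M (embed I Y1 Y2)) f M.
Proof.
move=> ij; apply: eq_bigr => I /eqP h; have h' := card_setC ij h.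
(* When Y1 or Y2 is not unitriangular the value is 0 by convention; the fibre is then empty, because
   diagonal blocks of a unitriangular matrix are unitriangular. *)
rewrite /stDefRes; case: ifP => [/andP[U1 U2]|nU]; last first.
  rewrite big1 ?mulr0 // => M /andP[UM /isUT_agree H].
  by rewrite H in nU.
set E := embed I Y1 Y2; have UE : isUT E by apply: isUT_embed.
have uE := isUT_unit UE; have LE : lz I E by apply: embed_lz.
rewrite card_isUR; congr (_ * _).
rewrite [RHS](reindex_onto (fun x => E *m x) (fun M => invmx E *m M)) /=; last first.
  by move=> M _; rewrite mulKVmx.
apply: eq_bigl => x; rewrite mulKmx // eqxx andbT isUR_agree.
apply/andP/andP=> -[Ux Ax]; split.
- exact: isUTM.
- by rewrite -[X in agree I _ X]mulmx1; apply: agree_mul.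
- by rewrite -[x](mulKmx uE) isUTM // isUT_inv.
by rewrite -[x](mulKmx uE) -(mulVmx uE) agree_mul // lz_inv.
Qed.

Lemma invmx_from_mul n (A B : 'M[F]_n) : A *m B = 1%:M -> invmx A = B.
Proof. by move=> AB; have [uA _] := mulmx1_unit AB; rewrite -[B](mulKmx uA) AB mulmx1. Qed.

Lemma conj_eq n (h A B : 'M[F]_n) : h \in unitmx ->
  (h *m A *m invmx h == h *m B *m invmx h) = (A == B).
Proof.
move=> uh; apply/eqP/eqP => [|-> //] /(congr1 (fun X => invmx h *m (X *m h))).
by rewrite !mulmxKV // !mulKmx.
Qed.

(** Conjugation by H = [embed I h1 h2], an element of UL_I, carries the fibre over (Y1, Y2) onto the
    fibre over the conjugated pair, and f is constant along it. The normalising factor depends on I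
    alone. *)
Lemma Delta_conj n i j (f : 'M[F]_n -> CC) h1 h2 Y1 Y2 : (i + j = n)%N ->
  is_cf f -> isUT h1 -> isUT h2 ->
  Delta i j f (h1 *m Y1 *m invmx h1) (h2 *m Y2 *m invmx h2) = Delta i j f Y1 Y2.
Proof.
move=> ij [_ fc] U1 U2; rewrite !Delta_kernel //; apply: eq_bigr => I /eqP h.
have h' := card_setC ij h; congr (_ * _).
set H := embed I h1 h2; have UH : isUT H by apply: isUT_embed.
have uH := isUT_unit UH; have LH : lz I H by apply: embed_lz.
have LV := lz_inv uH LH.
have e1 : invmx h1 = subm i (cinv I) (invmx H).
  by apply: invmx_from_mul; rewrite -(subm_embed h1 h2 h) -subm_mul // mulmxV // subm1.
have e2 : invmx h2 = subm j (cinv (~: I)) (invmx H).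
  by apply: invmx_from_mul; rewrite -(subm_embedC h1 h2 h') -subm_mulC // mulmxV // subm1.
rewrite (reindex_onto (fun M => H *m M *m invmx H) (fun M => invmx H *m M *m H)) /=; last first.
  by move=> M _; rewrite -!mulmxA mulmxV // mulmx1 mulKVmx.
apply: eq_big => [M|M /andP[/andP[UM _] _]]; last first.
  by apply: fc => //; move: UM; rewrite isUT_conj.
rewrite -!mulmxA mulVmx // mulmx1 mulKmx // eqxx andbT mulmxA isUT_conj //.
congr (_ && _); rewrite !agree_embed //.
have -> : lz I (H *m M *m invmx H) = lz I M.
  apply/idP/idP => L; last by rewrite !lzM.
  have -> : M = invmx H *m (H *m M *m invmx H) *m H.
    by rewrite -!mulmxA mulVmx // mulmx1 mulKmx.
  by apply: lzM => //; apply: lzM.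
rewrite !andbA; have [L|_] := boolP (lz I M); last by rewrite !andbF.
rewrite (subm_mul _ h LV) (subm_mul _ h L) (subm_mulC _ h' (lzM LH L)) (subm_mulC _ h' LH) -e1 -e2 subm_embed // subm_embedC //.
by rewrite !mulmxA !conj_eq ?isUT_unit.
Qed.

Lemma Delta_notUT n i j (f : 'M[F]_n -> CC) Y1 Y2 :
  ~~ (isUT Y1 && isUT Y2) -> Delta i j f Y1 Y2 = 0.
Proof. by move=> /negbTE U; rewrite /Delta big1 // => I _; rewrite /stDefRes U. Qed.

Lemma Delta_cf2 n i j (f : 'M[F]_n -> CC) : (i + j = n)%N ->
  is_cf f -> is_cf2 (Delta i j f).
Proof.
have inv1 m : invmx (1%:M : 'M[F]_m) = 1%:M by apply: invmx_from_mul; rewrite mulmx1.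
move=> ij cf; split=> Y; split=> [X U|g h Ug Uh].
- by apply: Delta_notUT; rewrite /isUT (negbTE U).
- by have := @Delta_conj n i j f h 1%:M g Y ij cf Uh (isUT1 F j); rewrite inv1 mulmx1 mul1mx.
- by apply: Delta_notUT; rewrite /isUT (negbTE U) andbF.
by have := @Delta_conj n i j f 1%:M h Y g ij cf (isUT1 F i) Uh; rewrite inv1 mulmx1 mul1mx.
Qed.

(** * The product: class functions, associativity, unit; then the counit *)

Lemma ulsubmx_subm i j (X : 'M[F]_(i + j)) : subm i id X = ulsubmx X.
Proof. by apply/matrixP=> r s; rewrite (@submE _ _ _ _ _ _ _ (lshift j r) (lshift j s)) // !mxE. Qed.

Lemma drsubmx_subm i j (X : 'M[F]_(i + j)) : subm j (addn i) X = drsubmx X.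
Proof. by apply/matrixP=> r s; rewrite (@submE _ _ _ _ _ _ _ (rshift i r) (rshift i s)) // !mxE. Qed.

Lemma isUT_dlsubmx i j (X : 'M[F]_(i + j)) : isUT X -> dlsubmx X = 0.
Proof.
move=> /isUTP U; apply/matrixP=> r s; rewrite !mxE U /=.
  by rewrite -val_eqE /= gtn_eqF // ltn_addr.
by rewrite ltnW // ltn_addr.
Qed.

Lemma ulsubmxM i j (X Y : 'M[F]_(i + j)) : isUT Y ->
  ulsubmx (X *m Y) = ulsubmx X *m ulsubmx Y.
Proof.
move=> UY; rewrite -{1}(submxK X) -{1}(submxK Y) mulmx_block block_mxKul.
by rewrite isUT_dlsubmx // mulmx0 addr0.
Qed.

Lemma drsubmxM i j (X Y : 'M[F]_(i + j)) : isUT X ->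
  drsubmx (X *m Y) = drsubmx X *m drsubmx Y.
Proof.
move=> UX; rewrite -{1}(submxK X) -{1}(submxK Y) mulmx_block block_mxKdr.
by rewrite isUT_dlsubmx // mul0mx add0r.
Qed.

Lemma isUT_subm_id n i (X : 'M[F]_n) : (i <= n)%N -> isUT X -> isUT (subm i id X).
Proof.
by move=> le; apply: isUT_subm => [r /leq_trans|r s /andP[]]; first exact.
Qed.

Lemma isUT_subm_addn n i j (X : 'M[F]_n) :
  (i + j <= n)%N -> isUT X -> isUT (subm j (addn i) X).
Proof. by move=> le; apply: isUT_subm => [r rj|r s /andP[rs sj]]; lia. Qed.

Lemma isUT_ulsubmx i j (X : 'M[F]_(i + j)) : isUT X -> isUT (ulsubmx X).
Proof. by rewrite -ulsubmx_subm; apply: isUT_subm_id; apply: leq_addr. Qed.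

Lemma isUT_drsubmx i j (X : 'M[F]_(i + j)) : isUT X -> isUT (drsubmx X).
Proof. by rewrite -drsubmx_subm; apply: isUT_subm_addn. Qed.

Lemma cf2_conj i j (G : 'M[F]_i -> 'M[F]_j -> CC) h1 h2 g1 g2 : is_cf2 G ->
  isUT h1 -> isUT h2 -> isUT g1 -> isUT g2 ->
  G (h1 *m g1 *m invmx h1) (h2 *m g2 *m invmx h2) = G g1 g2.
Proof.
move=> [G1 G2] U1 U2 V1 V2; have [_ ->] := G2 (h1 *m g1 *m invmx h1) => //.
by have [_ ->] := G1 g2.
Qed.

Lemma mu_cf n i j (G : 'M[F]_i -> 'M[F]_j -> CC) : (i + j = n)%N ->
  is_cf2 G -> is_cf (mu n i j G).
Proof.
move=> <- cG; split=> [X /negbTE U|g h Ug Uh]; first by rewrite /mu /isUT U.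
have {}Ug : isUT g := Ug; rewrite /mu isUT_conj // Ug !ulsubmx_subm !drsubmx_subm.
have UV := isUT_inv Uh.
have e1 : invmx (ulsubmx h) = ulsubmx (invmx h).
  apply: invmx_from_mul; rewrite -ulsubmxM // mulmxV ?isUT_unit //.
  by rewrite scalar_mx_block block_mxKul.
have e2 : invmx (drsubmx h) = drsubmx (invmx h).
  apply: invmx_from_mul; rewrite -drsubmxM // mulmxV ?isUT_unit //.
  by rewrite scalar_mx_block block_mxKdr.
rewrite !ulsubmxM // !drsubmxM // -?e1 -?e2 ?isUTM //.
by apply: cf2_conj; rewrite ?isUT_ulsubmx ?isUT_drsubmx.
Qed.

Lemma mu_assoc n i j k (G : 'M[F]_i -> 'M[F]_j -> 'M[F]_k -> CC) X :
  (i + j + k = n)%N ->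
  mu n (i + j)%N k (fun Y Z => mu (i + j)%N i j (fun Y1 Y2 => G Y1 Y2 Z) Y) X =
  mu n i (j + k)%N (fun Y Z => mu (j + k)%N j k (fun Z1 Z2 => G Y Z1 Z2) Z) X.
Proof.
move=> e; rewrite /mu; case: ifP => // UX.
rewrite isUT_subm_id ?isUT_subm_addn //; try lia.
by rewrite !subm_subm; try (move=> r /=; lia);
  congr (G _ _ _); apply: eq_subm => r _ /=; rewrite ?addnA.
Qed.

Lemma mu0n n (f : 'M[F]_n -> CC) X : is_cf f -> mu n 0 n (fun _ Y => f Y) X = f X.
Proof.
case=> f0 _; rewrite /mu; case: ifP => [_|/negbT /f0 -> //].
by rewrite (@eq_subm _ _ _ _ id) ?subm_id.
Qed.

Lemma mun0 n (f : 'M[F]_n -> CC) X : is_cf f -> mu n n 0 (fun Y _ => f Y) X = f X.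
Proof. by case=> f0 _; rewrite /mu subm_id; case: ifP => [_|/negbT /f0 ->]. Qed.

Lemma mx00 (X Y : 'M[F]_0) : X = Y.
Proof. by rewrite (flatmx0 X) (flatmx0 Y). Qed.

Lemma subm_setT n (X : 'M[F]_n) : subm n (cinv [set: 'I_n]) X = X.
Proof. by rewrite (@eq_subm _ _ _ _ id) ?subm_id // => r; apply: cinv_setT. Qed.

(** Only the empty set contributes. Its complement is everything, so the fibre over X contains at
    most X itself, and it is empty exactly when X is not unitriangular, where f vanishes. *)
Lemma Delta0n n (f : 'M[F]_n -> CC) X : is_cf f -> Delta 0 n f 1%:M X = f X.
Proof.
case=> f0 _; rewrite Delta_kernel // (big_pred1 set0) => [|I]; last by rewrite cards_eq0.
have -> : ninv (set0 : {set 'I_n}) = 0%N.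
  by apply: big1 => a _; apply: big1 => b _; rewrite inE andbF.
rewrite /qpow expn0 invr1 mul1r.
rewrite (eq_bigl (fun M => (M == X) && isUT M)) => [|M].
  rewrite big_mkcondr /= big_pred1_eq.
  by case: ifP => // /negbT/f0.
rewrite andbC; congr (_ && _); rewrite agree_embed ?cards0 //; last by rewrite setC0 cardsT card_ord.
rewrite (mx00 (subm _ _ _) 1%:M) eqxx setC0 subm_setT /=.
by case: eqP => //= _; apply/lzP=> a b; rewrite !inE.
Qed.

Lemma Deltan0 n (f : 'M[F]_n -> CC) X : is_cf f -> Delta n 0 f X 1%:M = f X.
Proof.
case=> f0 _; rewrite Delta_kernel ?addn0 // (big_pred1 setT) => [|I]; last first.
  apply/eqP/eqP => [e|->]; last by rewrite cardsT card_ord.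
  by apply/eqP; rewrite eqEcard subsetT cardsT card_ord e /=.
have -> : ninv ([set: 'I_n]) = 0%N.
  by apply: big1 => a _; apply: big1 => b _; rewrite !inE andbF.
rewrite /qpow expn0 invr1 mul1r.
rewrite (eq_bigl (fun M => (M == X) && isUT M)) => [|M].
  rewrite big_mkcondr /= big_pred1_eq.
  by case: ifP => // /negbT/f0.
rewrite andbC; congr (_ && _); rewrite agree_embed ?cardsT ?card_ord //; last by rewrite setCT cards0.
rewrite (mx00 (subm _ _ _) 1%:M) eqxx subm_setT /=.
by case: eqP => //= _; apply/lzP=> a b; rewrite !inE.
Qed.

(** * Coassociativity *)

Lemma big_subset_emb n k m (I : {set 'I_n}) (h : #|I| = k) (V : zmodType)
    (g : {set 'I_n} -> V) :
  \sum_(J : {set 'I_k} | #|J| == m) g (emb h @: J) =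
  \sum_(A : {set 'I_n} | (A \subset I) && (#|A| == m)) g A.
Proof.
rewrite [RHS](reindex_onto (fun J : {set 'I_k} => emb h @: J) (fun A : {set 'I_n} => emb h @^-1: A)) /=.
  apply: eq_bigl => J; rewrite card_imset; last exact: emb_inj.
  have -> : emb h @: J \subset I by apply/subsetP=> _ /imsetP[r _ ->]; apply: emb_mem.
  suff -> : emb h @^-1: (emb h @: J) = J by rewrite eqxx andbT.
  by apply/setP=> r; rewrite inE mem_imset //; exact: emb_inj.
move=> A /andP[AI _]; apply/setP=> x; apply/imsetP/idP => [[r]|xA].
  by rewrite inE => ? ->.
have [r e] := embP h (subsetP AI x xA).
by exists r; rewrite ?inE ?e.
Qed.

(** A chain A c I amounts to A together with I \ A, the form in which the right bracketing produces
    it. *)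
Lemma big_subset_setU n i j (A : {set 'I_n}) (V : zmodType) (g : {set 'I_n} -> V) :
  #|A| = i ->
  \sum_(B : {set 'I_n} | (B \subset ~: A) && (#|B| == j)) g (A :|: B) =
  \sum_(I : {set 'I_n} | (A \subset I) && (#|I| == i + j)%N) g I.
Proof.
move=> <-.
rewrite [RHS](reindex_onto (fun B => A :|: B) (fun I => I :\: A)) /=; last first.
  by move=> I /andP[AI _]; rewrite setDE setUIr setUCr setIT; apply/setUidPr.
apply: eq_bigl => B; rewrite subsetUl /= subsets_disjoint setCK disjoint_sym -setI_eq0.
have -> : ((A :|: B) :\: A == B) = (A :&: B == set0).
  rewrite setDUl setDv set0U.
  by apply/eqP/eqP => [<-|/setP e]; apply/setP=> x;
    [rewrite !inE; case: (x \in A) | have := e x; rewrite !inE; case: (x \in A) => //= ->].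
rewrite [RHS]andbC; case: (A :&: B =P set0) => //= e.
by rewrite cardsU e cards0 subn0 eqn_add2l.
Qed.

(** For A c I this counts the pairs a < b with a in a strictly earlier part than b, for the ordered
    partition A, I \ A, I^c. The disjunction counts a pair from A to I^c once. *)
Definition ninv3 n (A I : {set 'I_n}) : nat :=
  (\sum_(a : 'I_n) \sum_(b : 'I_n)
    ((a < b)%N && ((a \in A) && (b \notin A) || (a \in I) && (b \notin I))))%N.

Lemma ninv_emb n k (I : {set 'I_n}) (h : #|I| = k) (J : {set 'I_k}) :
  (ninv J = \sum_(a : 'I_n) \sum_(b : 'I_n)
    [&& (a < b)%N, a \in emb h @: J & b \in I :\: emb h @: J])%N.
Proof.
rewrite (bigID (mem I)) /= [X in (_ + X)%N]big1 ?addn0; last first.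
  move=> a aI; apply: big1 => b _.
  case: imsetP => [[r _ e]|]; last by rewrite andbF.
  by move: aI; rewrite e emb_mem.
rewrite -(big_emb _ h); apply: eq_bigr => r _.
rewrite (bigID (mem I)) /= [X in (_ + X)%N]big1 ?addn0; last first.
  by move=> b bI; rewrite inE (negbTE bI) !andbF.
rewrite -(big_emb _ h); apply: eq_bigr => s _.
rewrite emb_mono mem_imset; last exact: emb_inj.
by rewrite inE mem_imset ?emb_mem ?andbT //; exact: emb_inj.
Qed.

(** [ninv I] counts the pairs ending in I^c, and [ninv J] the remaining ones, from A to I \ A. *)
Lemma ninv3_l n k (I : {set 'I_n}) (h : #|I| = k) (J : {set 'I_k}) :
  (ninv I + ninv J)%N = ninv3 (emb h @: J) I.
Proof.
rewrite (ninv_emb h) -big_split; apply: eq_bigr => a _ /=.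
rewrite -big_split; apply: eq_bigr => b _ /=; rewrite inE.
case: (a < b)%N => //=; set A := emb h @: J.
have sub c : (c \in A) ==> (c \in I).
  by apply/implyP=> /imsetP[r _ ->]; apply: emb_mem.
by move: (sub a) (sub b); do 4!case: (_ \in _).
Qed.

(** Here [ninv A] counts the pairs starting in A, and [ninv J] those from the second part to the
    third. *)
Lemma ninv3_r n k (A : {set 'I_n}) (h : #|~: A| = k) (J : {set 'I_k}) :
  (ninv A + ninv J)%N = ninv3 A (A :|: emb h @: J).
Proof.
rewrite (ninv_emb h) -big_split; apply: eq_bigr => a _ /=.
rewrite -big_split; apply: eq_bigr => b _ /=; rewrite !inE.
case: (a < b)%N => //=; set B := emb h @: J.
have sub c : (c \in B) ==> (c \notin A).
  by rewrite -in_setC; apply/implyP=> /imsetP[r _ ->]; apply: emb_mem.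
by move: (sub a) (sub b); do 2!case: (_ \in A); do 2!case: (_ \in B).
Qed.

(** The term of a chain A c I in both bracketings. The two [lz] conditions together say that M is
    block upper triangular for the three parts. *)
Definition Delta3 n i j k (f : 'M[F]_n -> CC) (X : 'M[F]_i) (Y : 'M[F]_j)
    (Z : 'M[F]_k) (A I : {set 'I_n}) : CC :=
  (qpow (ninv3 A I))^-1 *
  \sum_(M | [&& isUT M, subm i (cinv A) M == X, subm j (cinv (I :\: A)) M == Y,
               subm k (cinv (~: I)) M == Z, lz A M & lz I M]) f M.

Lemma imset_embC n k (I : {set 'I_n}) (h : #|I| = k) (J : {set 'I_k}) :
  emb h @: (~: J) = I :\: emb h @: J.
Proof.
rewrite -{2}(imset_emb h); apply/setP=> x; rewrite inE.
apply/imsetP/andP=> [[r rJ ->]|[xJ /imsetP[r _ e]]].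
  by rewrite mem_imset ?imset_f ?inE -?in_setC //; exact: emb_inj.
by exists r => //; move: xJ; rewrite e mem_imset ?inE //; exact: emb_inj.
Qed.

Lemma subm_cinv_emb n m k (I : {set 'I_n}) (h : #|I| = m) (J : {set 'I_m})
    (M : 'M[F]_n) : #|J| = k ->
  subm k (cinv J) (subm m (cinv I) M) = subm k (cinv (emb h @: J)) M.
Proof.
move=> e; rewrite subm_subm => [|r rk]; last by rewrite cinv_lt ?e.
by apply: eq_subm => r rk /=; rewrite cinv_imset ?e.
Qed.

Lemma Delta_coassoc_l n i j k (f : 'M[F]_n -> CC) X Y Z : (i + j + k = n)%N ->
  Delta i j (fun W => Delta (i + j)%N k f W Z) X Y =
  \sum_(I : {set 'I_n} | #|I| == (i + j)%N)
    \sum_(A : {set 'I_n} | (A \subset I) && (#|A| == i)) Delta3 f X Y Z A I.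
Proof.
move=> ijk; rewrite Delta_kernel //.
under eq_bigr => J _.
  under eq_bigr => W _ do rewrite (Delta_kernel _ _ _ ijk).
  rewrite exchange_big mulr_sumr /=; over.
rewrite exchange_big; apply: eq_bigr => I /eqP h; have h' := card_setC ijk h.
rewrite -(big_subset_emb _ h); apply: eq_bigr => J /eqP hJ.
have hJ' := card_setC (erefl (i + j)%N) hJ.
rewrite -mulr_sumr mulrA /Delta3 -(ninv3_l h) qpowD invfM [X in X * _ = _]mulrC.
congr (_ * _).
(* The condition on M is split into a part free of W and the equation saying that W is the I-block
   of M, so that W can be summed out. *)
under eq_bigr => W _.
  rewrite (eq_bigl (fun M => [&& isUT M, subm k (cinv (~: I)) M == Z & lz I M] &&
      (subm (i + j) (cinv I) M == W))); last first.
    by move=> M; rewrite agree_embed //; do !case: (_ == _); rewrite ?andbF ?andbT.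
  over.
rewrite sum_fiber; apply: eq_bigl => M; have [UM|//] := boolP (isUT M).
rewrite isUT_subm_cinv //= agree_embed // !(subm_cinv_emb h) // imset_embC.
case: (_ == Z); rewrite ?andbF //=; case: (_ == X); rewrite ?andbF //=.
case: (_ == Y); rewrite ?andbF //=; have [/lzP L|] := boolP (lz I M); rewrite ?andbF ?andbT //.
(* Given [lz I M], rows outside I already vanish on A, so [lz A M] only concerns rows in I, that is,
   the I-block. *)
apply/lzP/lzP => H a b.
  move=> aA /imsetP[s sJ e]; have [aI|aI] := boolP (a \in I); last by rewrite L // e emb_mem.
  move: aA; have [r <-] := embP h aI; rewrite mem_imset; last exact: emb_inj.
  by move=> rJ; rewrite e -(subm_emb h) H.
by move=> aJ bJ; rewrite (subm_emb h) H ?mem_imset //; exact: emb_inj.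
Qed.

Lemma Delta_coassoc_r n i j k (f : 'M[F]_n -> CC) X Y Z : (i + j + k = n)%N ->
  Delta j k (Delta i (j + k)%N f X) Y Z =
  \sum_(A : {set 'I_n} | #|A| == i)
    \sum_(I : {set 'I_n} | (A \subset I) && (#|I| == (i + j)%N)) Delta3 f X Y Z A I.
Proof.
move=> ijk'; have ijk : (i + (j + k) = n)%N by rewrite addnA.
rewrite Delta_kernel //.
under eq_bigr => J _.
  under eq_bigr => W _ do rewrite (Delta_kernel _ _ _ ijk).
  rewrite exchange_big mulr_sumr /=; over.
rewrite exchange_big; apply: eq_bigr => A /eqP h; have h' := card_setC ijk h.
rewrite -(big_subset_setU _ _ h) -(big_subset_emb _ h'); apply: eq_bigr => J /eqP hJ.
have hJ' := card_setC (erefl (j + k)%N) hJ.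
rewrite -mulr_sumr mulrA /Delta3 -(ninv3_r h') qpowD invfM [X in X * _ = _]mulrC.
congr (_ * _).
set B := emb h' @: J.
have subBA c : c \in B -> c \notin A.
  by rewrite -in_setC => /imsetP[r _ ->]; apply: emb_mem.
have BA : (A :|: B) :\: A = B.
  rewrite setDUl setDv set0U; apply/setP=> x; rewrite inE.
  by case: (boolP (x \in B)) => [/subBA ->|]; rewrite ?andbF.
have BC : ~: (A :|: B) = emb h' @: ~: J by rewrite imset_embC -/B setCU setDE.
under eq_bigr => W _.
  rewrite (eq_bigl (fun M => [&& isUT M, subm i (cinv A) M == X & lz A M] &&
      (subm (j + k) (cinv (~: A)) M == W))); last first.
    by move=> M; rewrite agree_embed //; do !case: (_ == _); rewrite ?andbF ?andbT.
  over.
rewrite sum_fiber; apply: eq_bigl => M; have [UM|//] := boolP (isUT M).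
rewrite isUT_subm_cinv //= agree_embed // !(subm_cinv_emb h') // BA BC.
case: (_ == Z); rewrite ?andbF //=; case: (_ == X); rewrite ?andbF //=.
case: (_ == Y); rewrite ?andbF //=; have [/lzP L|] := boolP (lz A M); rewrite ?andbF ?andbT //.
(* Given [lz A M], the columns in A are already settled, so [lz] for the union of A and B only
   concerns the block on the complement of A. *)
apply/lzP/lzP => H a b.
  rewrite !inE negb_or => /andP[aA aB] /orP[bA|bB]; first exact: L.
  move: aA aB bB; rewrite -in_setC => aA; have [r <-] := embP h' aA.
  rewrite mem_imset; last exact: emb_inj.
  by move=> rJ /imsetP[s sJ ->]; rewrite -(subm_emb h') H.
move=> aJ bJ; rewrite (subm_emb h') H // !inE ?negb_or ?mem_imset ?aJ ?bJ ?orbT //; try exact: emb_inj.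
by rewrite -in_setC emb_mem.
Qed.

Lemma Delta_coassoc n i j k (f : 'M[F]_n -> CC) X Y Z : (i + j + k = n)%N ->
  Delta i j (fun W => Delta (i + j)%N k f W Z) X Y =
  Delta j k (Delta i (j + k)%N f X) Y Z.
Proof.
move=> ijk; rewrite Delta_coassoc_l // Delta_coassoc_r //.
rewrite (exchange_big_dep (fun A : {set 'I_n} => #|A| == i)) /= => [|I A _ /andP[]//].
by apply: eq_bigr => A Ai; apply: eq_bigl => I; rewrite Ai andbT andbC.
Qed.

End Coproduct.

(** * The coproduct is an algebra morphism *)

Section Multiplicativity.
Variable F : finFieldType.
Implicit Types a b i j : nat.

Lemma muT n i j (G : 'M[F]_i -> 'M[F]_j -> CC) (X : 'M[F]_n) : isUT X ->
  mu n i j G X = G (subm i id X) (subm j (addn i) X).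
Proof. by rewrite /mu => ->. Qed.

Lemma ent_subm n k f (X : 'M[F]_n) u v : (u < k)%N -> (v < k)%N ->
  ent (subm k f X) u v = ent X (f u) (f v).
Proof. by move=> uk vk; rewrite (@ent_eq _ _ _ (Ordinal uk) (Ordinal vk)) // mxE. Qed.

(** The elements of I below [a] take the first positions. This is why straightening is compatible
    with cutting a matrix into blocks at [a]. *)
Lemma clist_shift a b (I : {set 'I_(a + b)}) :
  clist I = clist (@lshift a b @^-1: I) ++ map (addn a) (clist (@rshift a b @^-1: I)).
Proof.
apply: clist_unique => [|k].
  rewrite sorted_pairwise; last exact: ltn_trans.
  rewrite pairwise_cat pairwise_map.
  have -> : pairwise (relpre (addn a) ltn) =1 pairwise ltn.
    by apply: eq_pairwise => u v /=; rewrite ltn_add2l.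
  rewrite -!(sorted_pairwise ltn_trans) !clist_sorted !andbT.
  apply/allrelP=> _ _ /clistP[x _ <-] /mapP[y _ ->].
  exact: leq_trans (ltn_ord x) (leq_addr _ _).
rewrite mem_cat; apply/orP/clistP => [[/clistP[x]|/mapP[_ /clistP[x] + <- ->]]|[x]].
- by rewrite inE => xI <-; exists (lshift b x).
- by rewrite inE => xI; exists (rshift a x).
case: (split_ordP x) => y -> yI <-; [left|right].
  by apply/clistP; exists y; rewrite ?inE.
by apply/mapP; exists (val y) => //; rewrite mem_clist inE.
Qed.

Lemma cano_lshift a b (I : {set 'I_(a + b)}) x : lshift b x \in I ->
  cano I (lshift b x) = cano (@lshift a b @^-1: I) x.
Proof.
move=> xI; rewrite /cano clist_shift index_cat.
by rewrite -[nat_of_ord (lshift b x)]/(val x) mem_clist inE xI.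
Qed.

Lemma cano_rshift a b (I : {set 'I_(a + b)}) (x : 'I_b) :
  cano I (rshift a x) = (#|@lshift a b @^-1: I| + cano (@rshift a b @^-1: I) x)%N.
Proof.
rewrite /cano clist_shift index_cat size_clist; case: clistP => [[y _ /= e]|_].
  by have := ltn_ord y; rewrite e /=; lia.
by rewrite /= index_map //; apply: addnI.
Qed.

Lemma embed_ul a b i j a1 a2 (I : {set 'I_(a + b)}) (Y1 : 'M[F]_i) (Y2 : 'M[F]_j) :
  #|@lshift a b @^-1: I| = a1 -> #|~: (@lshift a b @^-1: I)| = a2 ->
  ulsubmx (embed I Y1 Y2) = embed (@lshift a b @^-1: I) (subm a1 id Y1) (subm a2 id Y2).
Proof.
move=> h1 h2; have inC x : (lshift b x \in ~: I) = (x \in ~: (@lshift a b @^-1: I)) by rewrite !inE.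
apply/matrixP=> x y; rewrite !mxE !inE.
case: (boolP (_ && _)) => [/andP[xI yI]|_].
  by rewrite !cano_lshift // ent_subm // -h1 cano_lt ?inE.
case: (boolP (_ && _)) => [|//]; rewrite -!in_setC => /andP[xI yI].
by rewrite !cano_lshift // preimsetC ent_subm // -h2 cano_lt // -inC.
Qed.

Lemma embed_dr a b i j a1 a2 b1 b2 (I : {set 'I_(a + b)}) (Y1 : 'M[F]_i) (Y2 : 'M[F]_j) :
  #|@lshift a b @^-1: I| = a1 -> #|~: (@lshift a b @^-1: I)| = a2 ->
  #|@rshift a b @^-1: I| = b1 -> #|~: (@rshift a b @^-1: I)| = b2 ->
  drsubmx (embed I Y1 Y2) =
  embed (@rshift a b @^-1: I) (subm b1 (addn a1) Y1) (subm b2 (addn a2) Y2).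
Proof.
move=> h1 h2 k1 k2; have inC x : (rshift a x \in ~: I) = (x \in ~: (@rshift a b @^-1: I)) by rewrite !inE.
apply/matrixP=> x y; rewrite !mxE !inE.
case: (boolP (_ && _)) => [/andP[xI yI]|_].
  by rewrite !cano_rshift // ent_subm ?h1 // -k1 cano_lt ?inE.
case: (boolP (_ && _)) => [|//]; rewrite -!in_setC => /andP[xI yI].
by rewrite !cano_rshift // !preimsetC ent_subm ?h2 // -k2 cano_lt // -inC.
Qed.

Lemma isUT_block a b (U : 'M[F]_a) (T : 'M[F]_(a, b)) (V : 'M[F]_b) :
  isUT (block_mx U T 0 V) = isUT U && isUT V.
Proof.
apply/idP/andP=> [H|[/isUTP HU /isUTP HV]].
  have := isUT_ulsubmx H; have := isUT_drsubmx H.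
  by rewrite block_mxKul block_mxKdr.
apply/isUTP=> x y; case: (split_ordP x) => x' ->; case: (split_ordP y) => y' -> /= le.
- by rewrite block_mxEul HU // (inj_eq (@lshift_inj _ _)).
- by have := ltn_ord x'; lia.
- by rewrite block_mxEdl mxE -val_eqE /= gtn_eqF // ltn_addr.
by rewrite block_mxEdr HV ?(inj_eq (@rshift_inj _ _)) // -(leq_add2l a).
Qed.

Lemma agree_block a b (I : {set 'I_(a + b)}) (U : 'M[F]_a) (T : 'M[F]_(a, b))
    (V : 'M[F]_b) (E : 'M[F]_(a + b)) : dlsubmx E = 0 ->
  agree I (block_mx U T 0 V) E =
  [&& agree (@lshift a b @^-1: I) U (ulsubmx E),
      agree (@rshift a b @^-1: I) V (drsubmx E) &
      [forall x, forall y, ~~ ((x \in @lshift a b @^-1: I) && (y \notin @rshift a b @^-1: I))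
         ==> (T x y == ursubmx E x y)]].
Proof.
move=> E0; apply/agreeP/and3P => [H|[/agreeP HU /agreeP HV /'forall_forallP HT] x y].
  split.
  - by apply/agreeP=> x y; rewrite !inE => xy; rewrite !mxE -H ?block_mxEul.
  - by apply/agreeP=> x y; rewrite !inE => xy; rewrite !mxE -H ?block_mxEdr.
  apply/'forall_forallP=> x y; apply/implyP; rewrite negb_and negbK !inE => xy.
  by rewrite !mxE -H // block_mxEur.
case: (split_ordP x) => x' ->; case: (split_ordP y) => y' -> xy.
- by rewrite block_mxEul HU ?inE // !mxE.
- by rewrite block_mxEur; have := HT x' y'; rewrite negb_and negbK !inE xy => /eqP->; rewrite !mxE.
- by rewrite block_mxEdl -E0 !mxE.
by rewrite block_mxEdr HV ?inE // !mxE.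
Qed.

(* The block rows J1 x columns J2^c of M is free, which accounts for the power of q. *)
Lemma sum_agree_mu a b (I : {set 'I_(a + b)}) (E : 'M[F]_(a + b))
    (G : 'M[F]_a -> 'M[F]_b -> CC) : isUT E ->
  let J1 := @lshift a b @^-1: I in let J2 := @rshift a b @^-1: I in
  \sum_(M | isUT M && agree I M E) mu (a + b) a b G M =
  qpow F (\sum_x \sum_y ((x \in J1) && (y \notin J2)))%N *
  \sum_(U | isUT U && agree J1 U (ulsubmx E))
    \sum_(V | isUT V && agree J2 V (drsubmx E)) G U V.
Proof.
move=> UE J1 J2.
rewrite (reindex_onto
  (fun p : 'M[F]_a * 'M[F]_b * 'M[F]_(a, b) => block_mx p.1.1 p.2 0 p.1.2 : 'M[F]_(a + b))
  (fun M => (ulsubmx M, drsubmx M, ursubmx M))) /=; last first.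
  by move=> M /andP[UM _]; rewrite -{1}(isUT_dlsubmx UM) submxK.
pose cT := [pred T : 'M[F]_(a, b) | [forall x, forall y,
  ~~ ((x \in J1) && (y \notin J2)) ==> (T x y == ursubmx E x y)]].
rewrite (eq_bigl (fun p : 'M[F]_a * 'M[F]_b * 'M[F]_(a, b) =>
   ((isUT p.1.1 && agree J1 p.1.1 (ulsubmx E)) && (isUT p.1.2 && agree J2 p.1.2 (drsubmx E)))
   && cT p.2)); last first.
  move=> [[U V] T] /=; rewrite block_mxKul block_mxKdr block_mxKur eqxx andbT.
  rewrite isUT_block agree_block ?isUT_dlsubmx //.
  rewrite -/J1 -/J2; case: (isUT U); case: (isUT V); rewrite ?andbF //=.
  exact: andbA.
rewrite -(pair_big (fun p : 'M[F]_a * 'M[F]_b => (isUT p.1 && agree J1 p.1 (ulsubmx E)) && (isUT p.2 && agree J2 p.2 (drsubmx E))) cT (fun p T => mu (a + b) a b G (block_mx p.1 T 0 p.2))) /=.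
rewrite [X in _ = _ * X]pair_big mulr_sumr /=; apply: eq_bigr => -[U V] /= /andP[/andP[UU _] /andP[UV _]].
under eq_bigr => T _.
  rewrite /mu isUT_block UU UV /= ulsubmx_subm drsubmx_subm block_mxKul block_mxKdr; over.
by rewrite sumr_const card_mx_free /qpow mulr_natl.
Qed.

(** Across the cut the order is automatic: every pair from the first part to the second satisfies a
    < b, and no pair in the other direction does. *)
Lemma ninv_shift a b (I : {set 'I_(a + b)}) :
  let J1 := @lshift a b @^-1: I in let J2 := @rshift a b @^-1: I in
  ninv I = (ninv J1 + ninv J2 + \sum_x \sum_y ((x \in J1) && (y \notin J2)))%N.
Proof.
move=> J1 J2; rewrite /ninv big_split_ord /= addnAC -big_split /=; congr (_ + _)%N.
  apply: eq_bigr => x _; rewrite big_split_ord /=; congr (_ + _)%N; apply: eq_bigr => y _.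
    by rewrite !inE.
  by rewrite !inE /= (leq_trans (ltn_ord x)) ?leq_addr.
apply: eq_bigr => x _; rewrite big_split_ord /= big1 ?add0n.
  by apply: eq_bigr => y _; rewrite !inE ltn_add2l.
by move=> y _; rewrite ltnNge (leq_trans (ltnW (ltn_ord y))) ?leq_addr.
Qed.

Definition joinset a b (J1 : {set 'I_a}) (J2 : {set 'I_b}) : {set 'I_(a + b)} :=
  (@lshift a b @: J1) :|: (@rshift a b @: J2).

Lemma joinset_l a b (J1 : {set 'I_a}) (J2 : {set 'I_b}) :
  @lshift a b @^-1: joinset J1 J2 = J1.
Proof.
apply/setP=> x; rewrite !inE mem_imset; last exact: lshift_inj.
case: imsetP => [[y _ /(congr1 val) /= e]|]; rewrite ?orbF //.
by have := ltn_ord x; lia.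
Qed.

Lemma joinset_r a b (J1 : {set 'I_a}) (J2 : {set 'I_b}) :
  @rshift a b @^-1: joinset J1 J2 = J2.
Proof.
apply/setP=> x; rewrite !inE orbC mem_imset; last exact: rshift_inj.
case: imsetP => [[y _ /(congr1 val) /= e]|]; rewrite ?orbF //.
by have := ltn_ord y; lia.
Qed.

Lemma joinsetK a b (I : {set 'I_(a + b)}) :
  joinset (@lshift a b @^-1: I) (@rshift a b @^-1: I) = I.
Proof.
apply/setP=> x; rewrite inE; case: (split_ordP x) => y ->.
  by move/setP/(_ y): (joinset_l (@lshift a b @^-1: I) (@rshift a b @^-1: I)); rewrite !inE.
by move/setP/(_ y): (joinset_r (@lshift a b @^-1: I) (@rshift a b @^-1: I)); rewrite !inE.
Qed.

Lemma card_joinset a b (J1 : {set 'I_a}) (J2 : {set 'I_b}) :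
  #|joinset J1 J2| = (#|J1| + #|J2|)%N.
Proof.
rewrite cardsU !card_imset; try exact: lshift_inj; try exact: rshift_inj.
rewrite [X in (_ - X)%N](_ : _ = 0%N) ?subn0 //.
apply/eqP; rewrite cards_eq0; apply/eqP/setP=> x; rewrite !inE.
apply/negP=> /andP[/imsetP[y _ ->] /imsetP[z _ /(congr1 val) /= e]].
by have := ltn_ord y; lia.
Qed.

(** The index [a1] is the size of the part of I below [a]. The side conditions make the truncated
    difference [i - a1] a genuine size of a subset of 'I_b; outside them there is no such I. *)
Lemma big_joinset a b i (V : zmodType) (g : {set 'I_(a + b)} -> V) :
  \sum_(I : {set 'I_(a + b)} | #|I| == i) g I =
  \sum_(0 <= a1 < a.+1 | (a1 <= i)%N && (i - a1 <= b)%N)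
    \sum_(J1 : {set 'I_a} | #|J1| == a1)
      \sum_(J2 : {set 'I_b} | #|J2| == (i - a1)%N) g (joinset J1 J2).
Proof.
rewrite (reindex_onto (fun p : {set 'I_a} * {set 'I_b} => joinset p.1 p.2)
  (fun I => (@lshift a b @^-1: I, @rshift a b @^-1: I))) /=; last first.
  by move=> I _; apply: joinsetK.
rewrite (eq_bigl (fun p : {set 'I_a} * {set 'I_b} => true && (#|p.1| + #|p.2| == i)%N)); last first.
  by move=> [J1 J2] /=; rewrite joinset_l joinset_r eqxx andbT card_joinset.
rewrite -(pair_big_dep xpredT (fun (J1 : {set 'I_a}) (J2 : {set 'I_b}) => (#|J1| + #|J2| == i)%N)
  (fun J1 J2 => g (joinset J1 J2))) /=.
(* A dummy index [a1] forced to equal the size of J1 is inserted, after which the two outer sums can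
   be exchanged. *)
transitivity (\sum_(J1 : {set 'I_a}) \sum_(0 <= a1 < a.+1 | a1 == #|J1|)
   \sum_(J2 : {set 'I_b} | (a1 + #|J2| == i)%N) g (joinset J1 J2)).
  apply: eq_bigr => J1 _; rewrite big_nat1_eq /= ltnS.
  by have := max_card (mem J1); rewrite card_ord => ->.
rewrite (exchange_big_dep xpredT) //= big_mkcond [RHS]big_mkcond /=.
apply: eq_bigr => a1 _; case: ifP => [/andP[le1 le2]|nle].
  apply: eq_big => J1; first by rewrite eq_sym.
  by move=> _; apply: eq_bigl => J2; rewrite -(eqn_add2l a1 #|J2|) subnKC.
apply: big1 => J1 _; apply: big1 => J2 /eqP e; move: nle; rewrite -e leq_addr /= addKn.
by have := max_card (mem J2); rewrite card_ord => ->.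
Qed.

(** For fixed [a1], the cut at [a] and the set I produce blocks P, Q of Y1 and R, S of Y2. Feeding
    (P, R) to one inner coproduct and (Q, S) to the other is the swap of the middle tensor
    factors. *)
Lemma Delta_mu n a b (G : 'M[F]_a -> 'M[F]_b -> CC) i j (Y1 : 'M[F]_i) (Y2 : 'M[F]_j) :
  (a + b = n)%N -> (i + j = n)%N ->
  Delta i j (mu n a b G) Y1 Y2 =
  \sum_(0 <= a1 < a.+1 | (a1 <= i)%N && (i - a1 <= b)%N)
     mu i a1 (i - a1)%N (fun P Q =>
       mu j (a - a1)%N (b - (i - a1))%N (fun R S =>
         Delta a1 (a - a1)%N (fun U => Delta (i - a1)%N (b - (i - a1))%N (G U) Q S) P R)
       Y2) Y1.
Proof.
move=> abn; move: abn => <- ij.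
have [/andP[U1 U2]|nU] := boolP (isUT Y1 && isUT Y2); last first.
  rewrite Delta_notUT // big1 // => a1 _; rewrite /mu.
  by move: nU; case: (isUT Y1) => //= /negbTE ->.
rewrite Delta_kernel // big_joinset.
rewrite big_nat_cond [RHS]big_nat_cond.
apply: eq_bigr => a1 /andP[/andP[_ a1a] /andP[le1 le2]]; rewrite ltnS in a1a.
rewrite (muT _ U1) (muT _ U2) Delta_kernel; last by rewrite subnKC.
apply: eq_bigr => J1 /eqP h1; have h1' := card_setC (subnKC a1a) h1.
under [in RHS]eq_bigr => U _ do rewrite Delta_kernel ?subnKC //.
rewrite [in RHS]exchange_big mulr_sumr /=; apply: eq_bigr => J2 /eqP h2.
have h2' := card_setC (subnKC le2) h2.
set I := joinset J1 J2; have hI : #|I| = i by rewrite card_joinset h1 h2 subnKC.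
rewrite sum_agree_mu; last by apply: isUT_embed => //; apply: card_setC hI.
rewrite (@embed_ul _ _ _ _ a1 (a - a1)) ?joinset_l //.
rewrite (@embed_dr _ _ _ _ a1 (a - a1) (i - a1) (b - (i - a1))) ?joinset_l ?joinset_r //.
rewrite ninv_shift joinset_l joinset_r !qpowD -mulr_sumr !mulrA; congr (_ * _).
(* The power of q contributed by the free upper right block cancels the cross term of [ninv]. *)
rewrite !invfM mulfVK //; exact: qpow_neq0.
Qed.

End Multiplicativity.

(** * Linear maps between function spaces *)

Section LinearMaps.
Variables (T U : Type) (phi : (T -> CC) -> (U -> CC)).
Hypothesis lin : islinmap phi.

Lemma lin_add f g y : phi (fun x => f x + g x) y = phi f y + phi g y.
Proof.
have -> : (fun x => f x + g x) = (fun x => 1 * f x + g x).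
  by apply: functional_extensionality => x; rewrite mul1r.
by rewrite lin mul1r.
Qed.

Lemma lin_zero y : phi (fun=> 0) y = 0.
Proof.
have := lin_add (fun=> 0) (fun=> 0) y.
have -> : (fun _ : T => (0 : CC) + 0) = (fun=> 0).
  by apply: functional_extensionality => x; rewrite addr0.
by move/eqP; rewrite -subr_eq subrr eq_sym => /eqP.
Qed.

Lemma lin_scale c f y : phi (fun x => c * f x) y = c * phi f y.
Proof.
have -> : (fun x => c * f x) = (fun x => c * f x + (fun=> 0) x).
  by apply: functional_extensionality => x; rewrite addr0.
by rewrite lin lin_zero addr0.
Qed.

Lemma lin_sum (I : Type) (r : seq I) (P : pred I) (f : I -> T -> CC) y :
  phi (fun x => \sum_(i <- r | P i) f i x) y = \sum_(i <- r | P i) phi (f i) y.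
Proof.
elim: r => [|i r IH].
  rewrite [RHS]big_nil -[RHS](lin_zero y); congr (phi _ y).
  by apply: functional_extensionality => x; rewrite big_nil.
have -> : (fun x => \sum_(j <- i :: r | P j) f j x) =
    (fun x => (if P i then f i x else 0) + \sum_(j <- r | P j) f j x).
  by apply: functional_extensionality => x; rewrite big_cons; case: (P i); rewrite ?add0r.
rewrite lin_add IH big_cons; case: (P i) => //.
by rewrite lin_zero add0r.
Qed.

End LinearMaps.

(** * The convolution algebra and the antipode *)

Section Antipode.
Variable F : finFieldType.

(** Operators are defined on all functions, and preservation of class functions is the separate
    predicate [cf_op], so that an operator can be applied in one variable without carrying a
    membership proof. *)
Definition gradedop := forall n, ('M[F]_n -> CC) -> 'M[F]_n -> CC.
Definition lin_op (A : gradedop) := forall n, islinmap (A n).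
Definition cf_op (A : gradedop) := forall n f, is_cf f -> is_cf (A n f).

(** [Delta] is a finite linear combination of evaluations in M, so it commutes with a linear map
    acting on another tensor factor. *)
Lemma Delta_comm (T U : Type) (phi : (T -> CC) -> (U -> CC)) n i j
    (H : 'M[F]_n -> T -> CC) Y1 Y2 y : islinmap phi ->
  Delta i j (fun M => phi (H M) y) Y1 Y2 = phi (fun t => Delta i j (H^~ t) Y1 Y2) y.
Proof.
move=> lin; rewrite /Delta lin_sum //; apply: eq_bigr => I _; rewrite /stDefRes.
by case: ifP => _; [rewrite lin_scale // lin_sum | rewrite lin_zero].
Qed.

Lemma mu_comm (T U : Type) (phi : (T -> CC) -> (U -> CC)) n i j
    (H : T -> 'M[F]_i -> 'M[F]_j -> CC) X y : islinmap phi ->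
  phi (fun t => mu n i j (H t) X) y = mu n i j (fun P Q => phi (fun t => H t P Q) y) X.
Proof. by move=> lin; rewrite /mu; case: ifP => _ //; rewrite lin_zero. Qed.

Lemma mu_ext n i j (G H : 'M[F]_i -> 'M[F]_j -> CC) X :
  (forall P Q, G P Q = H P Q) -> mu n i j G X = mu n i j H X.
Proof. by move=> GH; rewrite /mu GH. Qed.

Lemma mu_sum n i j (I : Type) (r : seq I) (Pr : pred I)
    (H : I -> 'M[F]_i -> 'M[F]_j -> CC) X :
  mu n i j (fun P Q => \sum_(k <- r | Pr k) H k P Q) X =
  \sum_(k <- r | Pr k) mu n i j (H k) X.
Proof. by rewrite /mu; case: ifP => // _; rewrite big1. Qed.

Lemma mu_scale n i j c (H : 'M[F]_i -> 'M[F]_j -> CC) X :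
  mu n i j (fun P Q => c * H P Q) X = c * mu n i j H X.
Proof. by rewrite /mu; case: ifP => // _; rewrite mulr0. Qed.

Lemma Delta_linear n i j c (f g : 'M[F]_n -> CC) Y1 Y2 :
  Delta i j (fun M => c * f M + g M) Y1 Y2 = c * Delta i j f Y1 Y2 + Delta i j g Y1 Y2.
Proof.
rewrite /Delta mulr_sumr -big_split; apply: eq_bigr => I _; rewrite /stDefRes.
case: ifP => _ /=; last by rewrite mulr0 addr0.
by rewrite big_split /= -mulr_sumr mulrDr mulrCA.
Qed.

(** The convolution product mu o (A tensor B) o Delta: [B] acts on the second factor with the first
    as parameter, then [A] on the first. *)
Definition conv (A B : gradedop) : gradedop := fun n f X =>
  \sum_(i < n.+1) mu n i (n - i)%N
    (fun P Q => A i (fun P' => B (n - i)%N (Delta i (n - i)%N f P') Q) P) X.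

Lemma conv_lin_op (A B : gradedop) : lin_op A -> lin_op B -> lin_op (conv A B).
Proof.
move=> lA lB n c f g; apply: functional_extensionality => X.
rewrite /conv mulr_sumr -big_split; apply: eq_bigr => i _ /=.
rewrite -mu_scale /mu; case: ifP => _; last by rewrite addr0.
rewrite -(lin_scale (lA i)) -(lin_add (lA i)); congr (A i _ _).
apply: functional_extensionality => P.
rewrite -(lin_scale (lB _)) -(lin_add (lB _)); congr (B _ _ _).
by apply: functional_extensionality => Q; apply: Delta_linear.
Qed.

Lemma sum_cf n (I : Type) (r : seq I) (P : pred I) (f : I -> 'M[F]_n -> CC) :
  (forall i, is_cf (f i)) -> is_cf (fun X => \sum_(i <- r | P i) f i X).
Proof.
move=> cf; split=> [X U|g h Ug Uh]; first by apply: big1 => i _; apply: (cf i).1.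
by apply: eq_bigr => i _; apply: (cf i).2.
Qed.

Lemma scale_cf n c (f : 'M[F]_n -> CC) : is_cf f -> is_cf (fun X => c * f X).
Proof.
move=> cf; split=> [X U|g h Ug Uh]; first by rewrite cf.1 ?mulr0.
by rewrite cf.2.
Qed.

Lemma subnKC_ord n (i : 'I_n.+1) : (i + (n - i))%N = n.
Proof. by rewrite subnKC // -ltnS. Qed.

Lemma conv_cf_op (A B : gradedop) : lin_op A -> lin_op B -> cf_op A -> cf_op B -> cf_op (conv A B).
Proof.
move=> lA lB cA cB n f cf; apply: sum_cf => i; apply: mu_cf; first exact: subnKC_ord.
have [D1 D2] := Delta_cf2 (subnKC_ord i) cf.
split=> [Q|P].
  apply: cA; split=> [X U|g h Ug Uh].
    rewrite (_ : Delta _ _ f X = fun=> 0) ?lin_zero //.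
    by apply: functional_extensionality => Y; rewrite (D1 Y).1.
  congr (B _ _ _); apply: functional_extensionality => Y.
  exact: (D1 Y).2.
have cBP P' : is_cf (B (n - i)%N (Delta i (n - i)%N f P')) by apply: cB; apply: D2.
split=> [Y U|g h Ug Uh].
  rewrite (_ : (fun _ => _) = (fun=> 0)) ?lin_zero //.
  by apply: functional_extensionality => P'; rewrite (cBP P').1.
by congr (A _ _ _); apply: functional_extensionality => P'; rewrite (cBP P').2.
Qed.

Definition conv3 (A B C : gradedop) n (f : 'M[F]_n -> CC) X k l m : CC :=
  mu n k (l + m)%N (fun P1 R => mu (l + m)%N l m (fun P2 P3 =>
    A k (fun P1' => B l (fun P2' =>
      C m (Delta l m (Delta k (l + m)%N f P1') P2') P3) P2) P1) R) X.

Lemma conv3_l (A B C : gradedop) n f X k l m : lin_op C -> (k + l + m = n)%N ->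
  mu n (k + l)%N m (fun P Q => mu (k + l)%N k l (fun P1 P2 =>
    A k (fun P1' => B l (Delta k l (fun P' =>
      C m (Delta (k + l)%N m f P') Q) P1') P2) P1) P) X =
  conv3 A B C f X k l m.
Proof.
move=> lC klm; rewrite /conv3 -(mu_assoc (fun P1 P2 P3 => A k (fun P1' => B l (fun P2' =>
      C m (Delta l m (Delta k (l + m)%N f P1') P2') P3) P2) P1)) //.
apply: mu_ext => P Q; apply: mu_ext => P1 P2.
congr (A k _ _); apply: functional_extensionality => P1'.
congr (B l _ _); apply: functional_extensionality => P2'.
rewrite (Delta_comm _ _ _ _ (lC m)); congr (C m _ _).
by apply: functional_extensionality => Q'; apply: Delta_coassoc.
Qed.

Lemma conv3_r (A B C : gradedop) n f X k l m : lin_op A ->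
  mu n k (l + m)%N (fun P Q => A k (fun P' => mu (l + m)%N l m (fun P2 P3 =>
    B l (fun P2' => C m (Delta l m (Delta k (l + m)%N f P') P2') P3) P2) Q) P) X =
  conv3 A B C f X k l m.
Proof. by move=> lA; apply: mu_ext => P Q; rewrite mu_comm. Qed.

(** Both sides are the sum of [conv3] over k + l + m = n. Associativity of [mu] and coassociativity
    of [Delta] are both used in [conv3_l]; the other side only moves [A] past a product. *)
Lemma conv_assoc (A B C : gradedop) n (f : 'M[F]_n -> CC) X : lin_op A -> lin_op C ->
  conv (conv A B) C f X = conv A (conv B C) f X.
Proof.
move=> lA lC; pose t k l m := conv3 A B C f X k l m.
transitivity (\sum_(0 <= i < n.+1) \sum_(0 <= k < n.+1 | (k < i.+1)%N) t k (i - k)%N (n - i)%N).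
  rewrite big_mkord; apply: eq_bigr => i _; rewrite mu_sum.
  rewrite -(big_nat_widen 0 i.+1 n.+1 xpredT (fun k => t k (i - k)%N (n - i)%N)) //.
  rewrite big_mkord; apply: eq_bigr => k _.
  have kli : (k + (i - k) = i)%N by apply: subnKC_ord.
  have := subnKC_ord i; rewrite /t.
  (* The differences become variables l, m with k + l = i and i + m = n, so that substituting these
     equations leaves no casts between matrix types. *)
  move: (n - i)%N (i - k)%N kli => m l; case: i k => i /= _ [k /= _] <- e.
  exact: conv3_l.
rewrite (exchange_big_dep xpredT) //= big_mkord; apply: eq_bigr => k _.
rewrite -(big_nat_widenl k 0 n.+1 xpredT (fun i => t k (i - k)%N (n - i)%N)) //.
rewrite [LHS](big_addn 0 n.+1 k) subSn; last by rewrite -ltnS.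
transitivity (\sum_(l < (n - k).+1) t k l (n - k - l)%N).
  by rewrite big_mkord; apply: eq_bigr => l _; rewrite addnK addnC subnDA.
rewrite -[RHS](_ : mu n k (n - k)%N (fun P Q => \sum_(l < (n - k).+1) A k (fun P' =>
    mu (n - k)%N l (n - k - l)%N (fun P2 P3 => B l (fun P2' =>
      C (n - k - l)%N (Delta l (n - k - l)%N (Delta k (n - k)%N f P') P2') P3) P2) Q) P) X = _); last first.
  by apply: mu_ext => P Q; rewrite -lin_sum.
rewrite mu_sum; apply: eq_bigr => l _.
have := subnKC_ord l; rewrite /t; case: l => l /= _.
by move: (n - k - l)%N => m <-; rewrite -conv3_r.
Qed.

(** The unit of convolution, unit after counit; [convJ] is its complement in the identity, the
    projection onto positive degree. *)
Definition convE : gradedop := fun n f X => if n == 0%N then f X else 0.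
Definition convJ : gradedop := fun n f X => if n == 0%N then 0 else f X.

Lemma convE_lin : lin_op convE.
Proof.
by move=> n c f g; apply: functional_extensionality => X; rewrite /convE; case: ifP; rewrite ?mulr0 ?addr0.
Qed.

Lemma convJ_lin : lin_op convJ.
Proof.
by move=> n c f g; apply: functional_extensionality => X; rewrite /convJ; case: ifP; rewrite ?mulr0 ?addr0.
Qed.

Lemma convE_cf : cf_op convE.
Proof. by move=> n f cf; rewrite /convE; case: (n == 0%N). Qed.

Lemma convJ_cf : cf_op convJ.
Proof. by move=> n f cf; rewrite /convJ; case: (n == 0%N). Qed.

Lemma conv_congr_r (A B B' : gradedop) n (f : 'M[F]_n -> CC) X : is_cf f ->
  (forall m g Y, is_cf g -> B m g Y = B' m g Y) ->
  conv A B f X = conv A B' f X.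
Proof.
move=> cf BB; apply: eq_bigr => i _; apply: mu_ext => P Q; congr (A _ _ _).
apply: functional_extensionality => P'; apply: BB.
exact: (Delta_cf2 (subnKC_ord i) cf).2.
Qed.

Lemma conv_El (B : gradedop) n f X : cf_op B -> is_cf f -> conv convE B f X = B n f X.
Proof.
move=> cB cf; rewrite /conv big_ord_recl big1 ?addr0 => [|i _]; last first.
  by rewrite /convE /mu; case: ifP.
have : (n - @ord0 n = n)%N by rewrite subn0.
rewrite /convE /=; move: (n - 0)%N => j e; case: n / e f X cf => f X cf.
rewrite -(mu0n X (cB _ _ cf)); apply: mu_ext => P Q; congr (B _ _ _).
by apply: functional_extensionality => Y; rewrite (mx00 P 1%:M) Delta0n.
Qed.

Lemma conv_Er (A : gradedop) n f X : lin_op A -> cf_op A -> is_cf f -> conv A convE f X = A n f X.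
Proof.
move=> lA cA cf; rewrite /conv big_ord_recr /= big1 ?add0r => [|i _]; last first.
  rewrite -[RHS](_ : mu n i (n - i)%N (fun _ _ => 0) X = 0); last by rewrite /mu; case: ifP.
  apply: mu_ext => P Q; rewrite /convE subn_eq0 leqNgt ltn_ord /=.
  exact: lin_zero.
rewrite -(mun0 X (cA _ _ cf)).
have : (n - n = 0)%N by rewrite subnn.
move: (n - n)%N => j ->; apply: mu_ext => P Q; congr (A _ _ _).
by apply: functional_extensionality => Y; rewrite /convE /= (mx00 Q 1%:M) Deltan0.
Qed.

Lemma conv_suml (I : finType) (c : I -> CC) (A : gradedop) (Ak : I -> gradedop) (B : gradedop) n (f : 'M[F]_n -> CC) X :
  (forall m g Y, (m <= n)%N -> A m g Y = \sum_k c k * Ak k m g Y) ->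
  conv A B f X = \sum_k c k * conv (Ak k) B f X.
Proof.
move=> AA; under [RHS]eq_bigr => k _ do rewrite mulr_sumr.
rewrite exchange_big; apply: eq_bigr => i _.
under [RHS]eq_bigr => k _ do rewrite -mu_scale.
by rewrite -mu_sum; apply: mu_ext => P Q; apply: AA; rewrite -ltnS.
Qed.

Lemma conv_sumr (I : finType) (c : I -> CC) (A : gradedop) (B : gradedop) (Bk : I -> gradedop) n (f : 'M[F]_n -> CC) X :
  lin_op A -> (forall m g Y, (m <= n)%N -> B m g Y = \sum_k c k * Bk k m g Y) ->
  conv A B f X = \sum_k c k * conv A (Bk k) f X.
Proof.
move=> lA BB; under [RHS]eq_bigr => k _ do rewrite mulr_sumr.
rewrite exchange_big; apply: eq_bigr => i _.
under [RHS]eq_bigr => k _ do rewrite -mu_scale.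
rewrite -mu_sum; apply: mu_ext => P Q.
under [RHS]eq_bigr => k _ do rewrite -(lin_scale (lA _)).
rewrite -lin_sum //; congr (A _ _ _); apply: functional_extensionality => P'.
by apply: BB; rewrite leq_subr.
Qed.

Definition convpow k : gradedop := iter k (conv convJ) convE.

Lemma convpow_lin k : lin_op (convpow k).
Proof. by elim: k => [|k IH]; [exact: convE_lin | apply: conv_lin_op; [exact: convJ_lin|]]. Qed.

Lemma convpow_cf k : cf_op (convpow k).
Proof.
elim: k => [|k IH]; first exact: convE_cf.
by apply: conv_cf_op IH; [exact: convJ_lin | exact: convpow_lin | exact: convJ_cf].
Qed.

(** Each of the k factors [convJ] must receive positive degree, which is impossible when n < k. *)
Lemma convpow_small k n (f : 'M[F]_n -> CC) X : (n < k)%N -> convpow k f X = 0.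
Proof.
elim: k n f X => // k IH n f X nk; rewrite /convpow /= -/(convpow k).
apply: big1 => i _; rewrite /mu; case: ifP => // _.
rewrite /convJ; case: eqP => // /eqP i0; apply: IH.
by have := subnKC_ord i; lia.
Qed.

(** Powers are built by multiplying on the left; by associativity the new factor may sit on the
    right, as the left antipode identity requires. *)
Lemma convpowSr k n (f : 'M[F]_n -> CC) X : is_cf f ->
  conv (convpow k) convJ f X = convpow k.+1 f X.
Proof.
elim: k n f X => [|k IH] n f X cf.
  rewrite conv_El //; last exact: convJ_cf.
  by rewrite /convpow /= conv_Er //; [exact: convJ_lin | exact: convJ_cf].
rewrite /convpow !iterS -/(convpow k) conv_assoc; try exact: convJ_lin.
by apply: conv_congr_r => // m g Y cg; apply: IH.
Qed.

(* Takeuchi's formula. *)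
Definition antipode : gradedop := fun n f X => \sum_(k < n.+1) (-1) ^+ k * convpow k f X.

(** Frees the length of the sum from the degree, since a convolution evaluates the antipode in all
    degrees up to n at once. *)
Lemma antipode_ext N n f X : (n < N)%N ->
  antipode f X = \sum_(k < N) (-1) ^+ k * @convpow k n f X.
Proof.
move=> nN; rewrite /antipode (big_ord_widen N (fun k => (-1) ^+ k * @convpow k n f X)) //.
rewrite big_mkcond; apply: eq_bigr => k _; case: ifP => // /negbT.
by rewrite -leqNgt => nk; rewrite convpow_small ?mulr0.
Qed.

Lemma antipode_lin : lin_op antipode.
Proof.
move=> n c f g; apply: functional_extensionality => X.
rewrite /antipode mulr_sumr -big_split; apply: eq_bigr => k _ /=.
by rewrite convpow_lin mulrDr mulrCA.
Qed.

Lemma antipode_cf : cf_op antipode.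
Proof. by move=> n f cf; apply: sum_cf => k; apply: scale_cf; apply: convpow_cf. Qed.

Definition idop : gradedop := fun n f X => f X.

(** Writing this as a sum over booleans puts it in the form expected by [conv_suml] and
    [conv_sumr]. *)
Lemma idop_sum m g Y :
  @idop m g Y = \sum_(b : bool) 1 * (if b then convE else convJ) m g Y.
Proof.
by rewrite big_bool /= /convE /convJ !mul1r; case: ifP; rewrite ?addr0 ?add0r.
Qed.

Lemma antipode_telescope n f X :
  antipode f X + \sum_(k < n.+1) (-1) ^+ k * convpow k.+1 f X = @convE n f X.
Proof.
(* One extra term, which is zero, makes the tail of the sum match the shifted sum term by term with
   opposite signs; only the power 0 survives. *)
rewrite (@antipode_ext n.+2) // big_ord_recl expr0 mul1r -addrA -big_split big1 ?addr0 //=.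
by move=> k _; rewrite exprS mulN1r mulNr addNr.
Qed.

(** With S the antipode, S * id = S * E + S * J; the first term is S, and the second is the
    alternating sum of the powers of J shifted by one, so the telescope applies. *)
Lemma antipode_left n f X : is_cf f -> conv antipode idop f X = @convE n f X.
Proof.
move=> cf; rewrite (conv_sumr f X antipode_lin (fun m g Y _ => idop_sum g Y)).
rewrite big_bool !mul1r conv_Er //; [|exact: antipode_lin|exact: antipode_cf].
rewrite -antipode_telescope; congr (_ + _).
rewrite (@conv_suml _ (fun k : 'I_n.+1 => (-1) ^+ k) _ (fun k => convpow k)); last first.
  by move=> m g Y mn; apply: antipode_ext.
by apply: eq_bigr => k _; rewrite convpowSr.
Qed.

Lemma antipode_right n f X : is_cf f -> conv idop antipode f X = @convE n f X.
Proof.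
move=> cf; rewrite (conv_suml antipode f X (fun m g Y _ => idop_sum g Y)).
rewrite big_bool !mul1r conv_El //; last exact: antipode_cf.
rewrite -antipode_telescope; congr (_ + _).
rewrite (@conv_sumr _ (fun k : 'I_n.+1 => (-1) ^+ k) _ _ (fun k => convpow k)) //.
  exact: convJ_lin.
by move=> m g Y mn; apply: antipode_ext.
Qed.

End Antipode.

(** * Total orders as rank permutations, and their restrictions *)

Lemma card_ord_lt k m : (m <= k)%N -> #|[set z : 'I_k | (z < m)%N]| = m.
Proof.
move=> mk; rewrite -sum1dep_card -(big_ord_widen k (fun=> 1%N) mk).
by rewrite sum1_card card_ord.
Qed.

Lemma perm_rank k (s : 'S_k) a : val (s a) = #|[set b | (s b < s a)%N]|.
Proof.
rewrite -[LHS](@card_ord_lt k); last exact: ltnW (ltn_ord _).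
rewrite -(card_imset [set b | (s b < s a)%N] (@perm_inj _ s)); apply: eq_card => z.
by rewrite -(permKV s z) mem_imset ?inE //; apply: perm_inj.
Qed.

(** A rank permutation is recovered from its order by counting the elements below each point. *)
Lemma perm_mono_inj k (s t : 'S_k) :
  (forall a b, (s a < s b)%N = (t a < t b)%N) -> s = t.
Proof.
move=> st; apply/permP=> a; apply: val_inj; rewrite [LHS]perm_rank [RHS]perm_rank.
by apply: eq_card => b; rewrite !inE st.
Qed.

Lemma pvE k (s : 'S_k) (x : 'I_k) : pv s x = s x.
Proof. by rewrite /pv valK. Qed.

Section Restriction.
Variables (n k : nat) (I : {set 'I_n}) (h : #|I| = k) (s : 'S_n).

Lemma card_perm_imset : #|s @: I| = k.
Proof. by rewrite card_imset //; apply: perm_inj. Qed.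

Lemma restr_lt (r : 'I_k) : (cano (s @: I) (s (emb h r)) < k)%N.
Proof. by rewrite -[X in (_ < X)%N]card_perm_imset cano_lt // imset_f // emb_mem. Qed.

(** The rank of an element of I for the restricted order is its rank under s, counted among the
    ranks [s @: I] only. *)
Definition restr_fun (r : 'I_k) : 'I_k := Ordinal (restr_lt r).

Lemma emb_restr_fun (K : {set 'I_n}) (hK : #|K| = k) r : K = s @: I ->
  emb hK (restr_fun r) = s (emb h r).
Proof.
by move=> e; apply: val_inj; rewrite /= e canoK // imset_f // emb_mem.
Qed.

Lemma restr_fun_inj : injective restr_fun.
Proof.
move=> r t /(congr1 (emb card_perm_imset)); rewrite !emb_restr_fun //.
by move/perm_inj/emb_inj.
Qed.

Definition restr : 'S_k := perm restr_fun_inj.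

Lemma emb_restr (K : {set 'I_n}) (hK : #|K| = k) r : K = s @: I ->
  emb hK (restr r) = s (emb h r).
Proof. by rewrite permE; apply: emb_restr_fun. Qed.

Lemma isrestrE (s1 : 'S_k) : isrestr I s s1 = (s1 == restr).
Proof.
have e (a b : 'I_k) : (pv s (cinv I a) < pv s (cinv I b))%N = (restr a < restr b)%N.
  rewrite -!(val_emb h) !pvE -!(emb_restr card_perm_imset) //.
  exact: emb_mono.
apply/'forall_forallP/eqP => [H|->] ; last by move=> a b; rewrite e.
by apply: perm_mono_inj => a b; rewrite -e (eqP (H a b)).
Qed.

End Restriction.

(** * The map out of the Fock space and its bijectivity on coinvariants *)

Section Fock.
Variable F : finFieldType.

Lemma relabelM n (p : 'S_n) (X Y : 'M[F]_n) :
  relabel p (X *m Y) = relabel p X *m relabel p Y.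
Proof.
apply/matrixP=> a b; rewrite !mxE (reindex_inj (@perm_inj _ p)).
by apply: eq_bigr => c _; rewrite !mxE.
Qed.

Lemma relabel1 n (p : 'S_n) : relabel p (1%:M : 'M[F]_n) = 1%:M.
Proof. by apply/matrixP=> a b; rewrite !mxE (inj_eq (@perm_inj _ p)). Qed.

Lemma relabel_comp n (p q : 'S_n) (X : 'M[F]_n) :
  relabel p (relabel q X) = relabel (p * q)%g X.
Proof. by apply/matrixP=> a b; rewrite !mxE !permM. Qed.

Lemma relabel_perm1 n (X : 'M[F]_n) : relabel 1%g X = X.
Proof. by apply/matrixP=> a b; rewrite !mxE !perm1. Qed.

Lemma relabelK n (p : 'S_n) : cancel (@relabel F n p) (relabel p^-1%g).
Proof. by move=> X; rewrite relabel_comp mulVg relabel_perm1. Qed.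

Lemma relabelKV n (p : 'S_n) : cancel (relabel p^-1%g) (@relabel F n p).
Proof. by move=> X; rewrite relabel_comp mulgV relabel_perm1. Qed.

Lemma relabel_inv n (p : 'S_n) (X : 'M[F]_n) : X \in unitmx ->
  relabel p (invmx X) = invmx (relabel p X).
Proof. by move=> uX; apply/esym/invmx_from_mul; rewrite -relabelM mulmxV // relabel1. Qed.

Lemma isUTr_relabel n (p : 'S_n) (r r' : rel 'I_n) (X : 'M[F]_n) :
  (forall a b, r' a b = r (p a) (p b)) -> isUTr r' (relabel p X) = isUTr r X.
Proof.
move=> rr; apply/isUTrP/isUTrP => H a b; last first.
  by rewrite rr => /H; rewrite !mxE (inj_eq (@perm_inj _ p)).
rewrite -(permKV p a) -(permKV p b) -rr => /H.
by rewrite !mxE (inj_eq (@perm_inj _ p)).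
Qed.

Lemma isUTr_ordrel_relabel n (p : 'S_n) (X : 'M[F]_n) :
  isUTr (ordrel p) (relabel p X) = isUT X.
Proof. exact: isUTr_relabel. Qed.

Definition fock n (Phi : 'S_n * 'M[F]_n -> CC) : 'M[F]_n -> CC :=
  fun X => \sum_(p : 'S_n) Phi (p, relabel p X).

Lemma fock_lin n : islinmap (@fock n).
Proof.
move=> c f g; apply: functional_extensionality => X.
by rewrite /fock big_split -mulr_sumr.
Qed.

Lemma fock_cf n (Phi : 'S_n * 'M[F]_n -> CC) : Krep Phi -> is_cf (fock Phi).
Proof.
move=> K; split=> [X U|g h Ug Uh].
  by apply: big1 => p _; apply: (K p).1; rewrite isUTr_ordrel_relabel.
apply: eq_bigr => p _; rewrite !relabelM relabel_inv ?isUT_unit //.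
by apply: (K p).2; rewrite isUTr_ordrel_relabel.
Qed.

Lemma fock_Kact n (p : 'S_n) (Phi : 'S_n * 'M[F]_n -> CC) : fock (Kact p Phi) = fock Phi.
Proof.
apply: functional_extensionality => X; rewrite /fock [RHS](reindex_inj (mulgI p)).
by apply: eq_bigr => q _; rewrite /Kact /= relabel_comp.
Qed.

(* The component of Phi at the order p is moved to the standard order by p. *)
Lemma fock_inj n (Phi : 'S_n * 'M[F]_n -> CC) : Krep Phi ->
  (forall X, fock Phi X = 0) ->
  exists w : 'S_n -> 'S_n * 'M[F]_n -> CC, (forall p, Krep (w p)) /\
    forall q, Phi q = \sum_(p : 'S_n) (w p q - Kact p (w p) q).
Proof.
(* The witness [w p] is the component of Phi at the order p. [Kact p] moves it to the identity
   order, and the moved components add up there to [fock Phi], which is zero. *)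
move=> K Phi0; exists (fun p q => if q.1 == p then Phi q else 0); split=> [p s|[s X]].
  by rewrite /=; case: eqP.
rewrite sumrB -big_mkcond /= (big_pred1 s) => [|p]; last by rewrite /= eq_sym.
rewrite /Kact /=; have e p : (p * s == p)%g = (s == 1%g).
  by rewrite -{2}[p]mulg1 (inj_eq (mulgI p)).
under [X in _ - X]eq_bigr => p _ do rewrite e.
have [->|_] := eqVneq s 1%g; last by rewrite big1 ?subr0.
under [X in _ - X]eq_bigr => p _ do rewrite mulg1.
by rewrite -[X in _ - X]/(fock Phi X) Phi0 subr0.
Qed.

Lemma fock_surj n (f : 'M[F]_n -> CC) : is_cf f ->
  exists Phi, Krep Phi /\ forall X, fock Phi X = f X.
Proof.
move=> cf; exists (fun q => if q.1 == 1%g then f q.2 else 0); split=> [s|X].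
  have [-> /=|//] := eqVneq s 1%g.
  have e (X : 'M[F]_n) : isUTr (ordrel 1%g) X = isUT X by rewrite -{1}(relabel_perm1 X) isUTr_ordrel_relabel.
  by split=> [X|g h]; rewrite !e; [apply: cf.1 | apply: cf.2].
by rewrite /fock (bigD1 1%g) //= eqxx relabel_perm1 big1 ?addr0 // => p /negbTE ->.
Qed.

(** * Compatibility with products *)

Section Concat.
Variables (i j : nat) (s1 : 'S_i) (s2 : 'S_j).

Definition concat_fun (x : 'I_(i + j)) : 'I_(i + j) :=
  match split x with inl y => lshift j (s1 y) | inr z => rshift i (s2 z) end.

Lemma concat_fun_l y : concat_fun (lshift j y) = lshift j (s1 y).
Proof. by rewrite /concat_fun -[lshift j y]/(unsplit (inl y)) unsplitK. Qed.

Lemma concat_fun_r y : concat_fun (rshift i y) = rshift i (s2 y).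
Proof. by rewrite /concat_fun -[rshift i y]/(unsplit (inr y)) unsplitK. Qed.

Lemma concat_fun_inj : injective concat_fun.
Proof.
move=> x y; case: (split_ordP x) => x' ->; case: (split_ordP y) => y' ->;
  rewrite ?concat_fun_l ?concat_fun_r.
- by move/lshift_inj/perm_inj ->.
- by move/(congr1 val) => /= e; have := ltn_ord (s1 x'); lia.
- by move/(congr1 val) => /= e; have := ltn_ord (s1 y'); lia.
by move/rshift_inj/perm_inj ->.
Qed.

Definition concat : 'S_(i + j) := perm concat_fun_inj.

Lemma isconcatE s : isconcat s s1 s2 = (s == concat).
Proof.
have e (a : 'I_(i + j)) : val (concat a) = if (a < i)%N then pv s1 a else (i + pv s2 (a - i))%N.
  rewrite permE; case: (split_ordP a) => y ->.
    by rewrite concat_fun_l -[nat_of_ord (lshift j y)]/(val y) pvE.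
  by rewrite concat_fun_r /= addKn pvE.
apply/forallP/eqP => [H|-> a]; last by rewrite e.
by apply/permP=> a; apply: val_inj; rewrite e; apply/eqP.
Qed.

Lemma subm_relabel_concat_l (X : 'M[F]_(i + j)) :
  subm i id (relabel concat X) = relabel s1 (subm i id X).
Proof. by rewrite !ulsubmx_subm; apply/matrixP=> r t; rewrite !mxE !permE !concat_fun_l. Qed.

Lemma subm_relabel_concat_r (X : 'M[F]_(i + j)) :
  subm j (addn i) (relabel concat X) = relabel s2 (subm j (addn i) X).
Proof. by rewrite !drsubmx_subm; apply/matrixP=> r t; rewrite !mxE !permE !concat_fun_r. Qed.

End Concat.

(** For given s1 and s2 the sum over s has the single term s = [concat s1 s2], and relabelling by it
    acts on the two diagonal blocks by s1 and s2. *)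
Lemma fock_Kmu n i j (Psi : 'S_i * 'M[F]_i -> 'S_j * 'M[F]_j -> CC) X :
  (i + j = n)%N ->
  fock (Kmu n i j Psi) X = mu n i j (tens (@fock i) (@fock j) Psi) X.
Proof.
move=> ij; case: n / ij X => X; rewrite /fock /Kmu /mu /=.
under eq_bigr => s _ do under eq_bigr => s1 _ do under eq_bigr => s2 _ do
  rewrite isUTr_ordrel_relabel andbC.
case: ifP => _ /=; last by apply: big1 => s _; apply: big1 => s1 _; apply: big1.
rewrite exchange_big; apply: eq_bigr => s1 _; rewrite exchange_big; apply: eq_bigr => s2 _.
rewrite -big_mkcond (big_pred1 (concat s1 s2)) => [|s]; last by rewrite /= isconcatE.
by rewrite subm_relabel_concat_l subm_relabel_concat_r.
Qed.

(** * Compatibility with coproducts *)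

Lemma imset_permC n (s : 'S_n) (I : {set 'I_n}) : s @: (~: I) = ~: (s @: I).
Proof.
apply/setP=> x; rewrite -(permKV s x) inE !mem_imset ?inE //; exact: perm_inj.
Qed.

Lemma relabel_embed n i j (I : {set 'I_n}) (h : #|I| = i) (h' : #|~: I| = j) (s : 'S_n)
    (Y1 : 'M[F]_i) (Y2 : 'M[F]_j) :
  relabel s (embed (s @: I) Y1 Y2) =
  embed I (relabel (restr h s) Y1) (relabel (restr h' s) Y2).
Proof.
have mI a : (s a \in s @: I) = (a \in I) by rewrite mem_imset //; apply: perm_inj.
have hK := card_perm_imset h s.
have hK' : #|~: (s @: I)| = j by rewrite -imset_permC (card_perm_imset h').
apply/matrixP=> a b; rewrite mxE.
have [aI|aI] := boolP (a \in I); have [bI|bI] := boolP (b \in I).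
- have [r <-] := embP h aI; have [t <-] := embP h bI.
  by rewrite -!(emb_restr h hK) // !embed_in mxE.
- by rewrite !embed_off // ?mI aI (negbTE bI).
- by rewrite !embed_off // ?mI bI (negbTE aI).
move: aI bI; rewrite -!in_setC => aI bI.
have [r <-] := embP h' aI; have [t <-] := embP h' bI.
by rewrite -!(emb_restr h' hK') ?imset_permC // !embed_out mxE.
Qed.

(** Stated for any commutative monoid law, so that it yields both the averaging sum and the order of
    the subgroup averaged over. *)
Lemma big_isRs n (I : {set 'I_n}) (s : 'S_n) (R : Type) (idx : R)
    (oper : Monoid.com_law idx) (g : 'M[F]_n -> R) :
  \big[oper/idx]_(x | isRs I s x) g x =
  \big[oper/idx]_(x | isUR (s @: I) x) g (relabel s x).
Proof.
rewrite (reindex_onto (relabel s) (relabel s^-1%g)) => [|x _]; last by rewrite relabelKV.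
apply: eq_bigl => x; rewrite relabelK eqxx andbT; apply: isUTr_relabel => a b.
by rewrite !mem_imset //; apply: perm_inj.
Qed.

Lemma card_isRs n (I : {set 'I_n}) (s : 'S_n) :
  #|[pred x : 'M[F]_n | isRs I s x]| = #|[pred x : 'M[F]_n | isUR (s @: I) x]|.
Proof. by rewrite -!sum1_card big_isRs. Qed.

(** On the left a set K of ranks is chosen, on the right a set I of labels; for each order s they
    correspond by K = s(I). Since s and I determine both restricted orders, the sums over s1 and s2
    reduce to one term each. *)
Lemma fock_Delta n i j (Phi : 'S_n * 'M[F]_n -> CC) Y1 Y2 : (i + j = n)%N ->
  Delta i j (fock Phi) Y1 Y2 = tens (@fock i) (@fock j) (KDelta i j Phi) Y1 Y2.
Proof.
move=> ij; rewrite /tens /fock /KDelta /Delta /=.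
under [RHS]eq_bigr => s1 _ do under eq_bigr => s2 _ do under eq_bigr => I _ do
  under eq_bigr => s _ do rewrite !isUTr_ordrel_relabel.
rewrite /stDefRes; case: (isUT Y1 && isUT Y2); last first.
  rewrite big1 // big1 // => s1 _; apply: big1 => s2 _; apply: big1 => I _.
  exact: big1.
transitivity (\sum_(s : 'S_n) \sum_(K : {set 'I_n} | #|K| == i)
    (#|[pred x : 'M[F]_n | isUR K x]|%:R)^-1 *
      \sum_(x | isUR K x) Phi (s, relabel s (embed K Y1 Y2 *m x))).
  rewrite exchange_big; apply: eq_bigr => K _ /=; rewrite -mulr_sumr; congr (_ * _).
  exact: exchange_big.
transitivity (\sum_(s : 'S_n) \sum_(I : {set 'I_n} | #|I| == i)
   \sum_(s1 : 'S_i | isrestr I s s1) \sum_(s2 : 'S_j | isrestr (~: I) s s2)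
    (#|[pred x : 'M[F]_n | isRs I s x]|%:R)^-1 *
      \sum_(x | isRs I s x) Phi (s, embed I (relabel s1 Y1) (relabel s2 Y2) *m x)).
  apply: eq_bigr => s _.
  rewrite (reindex_onto (fun I : {set 'I_n} => s @: I) (fun K : {set 'I_n} => s @^-1: K)) /=; last first.
    move=> K _; apply/setP=> x; rewrite -(permKV s x) mem_imset ?inE //; exact: perm_inj.
  apply: eq_big => [I|I /andP[/eqP hK _]].
    rewrite card_imset; last exact: perm_inj.
    suff -> : s @^-1: (s @: I) = I by rewrite eqxx andbT.
    by apply/setP=> x; rewrite inE mem_imset //; apply: perm_inj.
  have h : #|I| = i by rewrite -hK card_imset //; apply: perm_inj.
  have h' := card_setC ij h.
  rewrite (big_pred1 (restr h s)) => [|s1]; last exact: isrestrE.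
  rewrite (big_pred1 (restr h' s)) => [|s2]; last exact: isrestrE.
  rewrite card_isRs big_isRs; congr (_ * _); apply: eq_bigr => x _.
  by rewrite relabelM (relabel_embed h h').
rewrite exchange_big /=; under [RHS]eq_bigr => s1 _ do rewrite exchange_big /=.
rewrite [RHS]exchange_big /=; apply: eq_bigr => I _.
rewrite (exchange_big_dep xpredT) //=; apply: eq_bigr => s1 _.
rewrite [RHS](exchange_big_dep (fun s => isrestr I s s1)) /= => [|s2 s _ /andP[]//].
by apply: eq_bigr => s r1; apply: eq_bigl => s2; rewrite r1.
Qed.

End Fock.

Theorem theorem5p5 (F : finFieldType) :
  (* ===== (1) cf(UT_.) is a graded connected Hopf algebra ===== *)
  (* the structure maps are well defined (graded) *)
  (forall n i j, (i + j)%N = n -> forall G : 'M[F]_i -> 'M[F]_j -> CC, is_cf2 G -> is_cf (mu n i j G)) /\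
  (forall n i j, (i + j)%N = n -> forall f : 'M[F]_n -> CC, is_cf f ->
      is_cf2 (Delta i j f)) /\
  (* connected: cf(UT_0) = C (spanned by the unit) *)
  (forall f : 'M[F]_0 -> CC, is_cf f -> forall X, f X = f 1%:M) /\
  (* associativity *)
  (forall n i j k, (i + j + k)%N = n ->
    forall G : 'M[F]_i -> 'M[F]_j -> 'M[F]_k -> CC, is_cf3 G ->
    forall X : 'M[F]_n,
      mu n (i + j)%N k (fun Y Z => mu (i + j)%N i j (fun Y1 Y2 => G Y1 Y2 Z) Y) X =
      mu n i (j + k)%N (fun Y Z => mu (j + k)%N j k (fun Z1 Z2 => G Y Z1 Z2) Z) X) /\
  (* unit (the unit is the constant function 1 on UT_0) *)
  (forall n (f : 'M[F]_n -> CC), is_cf f -> forall X,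
      mu n 0 n (fun _ Y => f Y) X = f X /\ mu n n 0 (fun Y _ => f Y) X = f X) /\
  (* coassociativity *)
  (forall n i j k, (i + j + k)%N = n -> forall f : 'M[F]_n -> CC, is_cf f ->
    forall (X : 'M[F]_i) (Y : 'M[F]_j) (Z : 'M[F]_k),
      Delta i j (fun W => Delta (i + j)%N k f W Z) X Y =
      Delta j k (Delta i (j + k)%N f X) Y Z) /\
  (* counit (epsilon = evaluation at the identity of UT_0, zero in degree > 0) *)
  (forall n (f : 'M[F]_n -> CC), is_cf f -> forall X,
      Delta 0 n f 1%:M X = f X /\ Delta n 0 f X 1%:M = f X) /\
  (* unit and counit are compatible with (co)product in degree 0 *)
  (forall G : 'M[F]_0 -> 'M[F]_0 -> CC, mu 0 0 0 G 1%:M = G 1%:M 1%:M) /\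
  (forall X Y, Delta 0 0 (fun _ : 'M[F]_0 => (1 : CC)) X Y = 1) /\
  (* Delta is an algebra morphism *)
  (forall n a b, (a + b)%N = n -> forall G : 'M[F]_a -> 'M[F]_b -> CC, is_cf2 G ->
    forall i j, (i + j)%N = n -> forall (Y1 : 'M[F]_i) (Y2 : 'M[F]_j),
      Delta i j (mu n a b G) Y1 Y2 =
      \sum_(0 <= a1 < a.+1 | (a1 <= i)%N && (i - a1 <= b)%N)
         mu i a1 (i - a1)%N (fun P Q =>
           mu j (a - a1)%N (b - (i - a1))%N (fun R S =>
             Delta a1 (a - a1)%N (fun U => Delta (i - a1)%N (b - (i - a1))%N (G U) Q S) P R)
           Y2) Y1) /\
  (* existence of the antipode *)
  (exists S : forall n, ('M[F]_n -> CC) -> ('M[F]_n -> CC),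
    (forall n, islinmap (S n)) /\
    (forall n (f : 'M[F]_n -> CC), is_cf f -> is_cf (S n f)) /\
    (forall n (f : 'M[F]_n -> CC), is_cf f -> forall X,
       \sum_(i < n.+1)
          mu n i (n - i)%N (fun P Q => S i (fun P' => Delta i (n - i)%N f P' Q) P) X
         = (if n == 0%N then f X else 0) /\
       \sum_(i < n.+1)
          mu n i (n - i)%N (fun P Q => S (n - i)%N (Delta i (n - i)%N f P) Q) X
         = (if n == 0%N then f X else 0))) /\
  (* ===== (2) a graded Hopf algebra isomorphism  K(cf) ~= cf(UT_.) ===== *)
  (* phi n : cf[[n]] -> cf(UT_n) induces a linear isomorphism from the
     S_n-coinvariants K(cf)_n onto cf(UT_n) compatible with (co)products *)
  (exists phi : forall n, ('S_n * 'M[F]_n -> CC) -> ('M[F]_n -> CC),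
    (forall n, islinmap (phi n)) /\
    (forall n (Phi : 'S_n * 'M[F]_n -> CC), Krep Phi -> is_cf (phi n Phi)) /\
    (* factors through the coinvariants *)
    (forall n (p : 'S_n) (Phi : 'S_n * 'M[F]_n -> CC), Krep Phi -> phi n (Kact p Phi) = phi n Phi) /\
    (* the induced map on coinvariants is injective *)
    (forall n (Phi : 'S_n * 'M[F]_n -> CC), Krep Phi -> (forall X, phi n Phi X = 0) ->
       exists w : 'S_n -> 'S_n * 'M[F]_n -> CC,
         (forall p, Krep (w p)) /\
         forall q, Phi q = \sum_(p : 'S_n) (w p q - Kact p (w p) q)) /\
    (* ... and surjective *)
    (forall n (f : 'M[F]_n -> CC), is_cf f ->
       exists Phi, Krep Phi /\ forall X, phi n Phi X = f X) /\
    (* compatible with products *)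
    (forall n i j, (i + j)%N = n -> forall Psi : 'S_i * 'M[F]_i -> 'S_j * 'M[F]_j -> CC, Krep2 Psi ->
       forall X, phi n (Kmu n i j Psi) X = mu n i j (tens (phi i) (phi j) Psi) X) /\
    (* compatible with coproducts *)
    (forall n i j, (i + j)%N = n -> forall Phi : 'S_n * 'M[F]_n -> CC, Krep Phi ->
       forall (Y1 : 'M[F]_i) (Y2 : 'M[F]_j),
         Delta i j (phi n Phi) Y1 Y2 = tens (phi i) (phi j) (KDelta i j Phi) Y1 Y2)).
Proof.
split; first by move=> n i j ij G; apply: mu_cf.
split; first by move=> n i j ij f; apply: Delta_cf2.
split; first by move=> f _ X; rewrite (mx00 X 1%:M).
split; first by move=> n i j k ijk G _ X; apply: mu_assoc.
split; first by move=> n f cf X; rewrite mu0n // mun0.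
split; first by move=> n i j k ijk f _ X Y Z; apply: Delta_coassoc.
split; first by move=> n f cf X; rewrite Delta0n // Deltan0.
split; first by move=> G; rewrite /mu isUT1; congr (G _ _); apply: mx00.
split.
  move=> X Y; rewrite (mx00 X 1%:M) Delta0n //.
  by split=> // M; rewrite -[isUTr _ _]/(isUT M) (mx00 M 1%:M) isUT1.
split; first by move=> n a b ab G _ i j ij Y1 Y2; apply: Delta_mu.
split.
  exists (@antipode F); split; first exact: antipode_lin.
  split; first exact: antipode_cf.
  by move=> n f cf X; split; [apply: antipode_left | apply: antipode_right].
exists (@fock F); split; first exact: fock_lin.
split; first by move=> n Phi; apply: fock_cf.
split; first by move=> n p Phi _; apply: fock_Kact.
split; first by move=> n Phi; apply: fock_inj.
split; first by move=> n f; apply: fock_surj.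
split; first by move=> n i j ij Psi _ X; apply: fock_Kmu.
by move=> n i j ij Phi _ Y1 Y2; apply: fock_Delta.
Qed.
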